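(* For every $k\geq8$ and $1\leq r\leq\infty$ there exist $\Phi\in\mathrm{SRT}^r_{k+1}(\mathbb{S}^1)$ and $\Psi\in\mathrm{SRT}^r_k(\mathbb{S}^1)$ such that: (i) $\mathcal{F}^{uu}(\Phi)$ is minimal but $\mathcal{F}^{ss}(\Phi)$ is not minimal; (ii) neither $\mathcal{F}^{uu}(\Psi)$ nor $\mathcal{F}^{ss}(\Psi)$ is minimal.
   Context: $\mathrm{IFS}^r_k(\mathbb{S}^1)$ is the set of families of $k$ orientation-preserving $C^r$ circle diffeomorphisms, identified up to reordering, with metric $\bar{\mathrm{d}}_r(\mathscr{F},\mathscr{G})=\min_{\sigma\in S_k}\sum_i\mathrm{d}_r(f_i,g_{\sigma(i)})$ ($\mathrm{d}_r$ the $C^r$ distance). $\Sigma_k=\{1,\dots,k\}^{\mathbb{Z}}$ with metric $\nu^m$, $m=\min\{i\geq0:\omega_i\ne\omega'_i\text{ or }\omega_{-i}\neq\omega'_{-i}\}$, $0<\nu<1$, shift $\tau$. $\mathrm{S}^r_k(\mathbb{S}^1)$ is the set of skew-products $\tau\ltimes\mathscr{F}(\omega,x)=(\tau\omega,f_{\omega_0}(x))$, $\mathscr{F}\in\mathrm{IFS}^r_k(\mathbb{S}^1)$, topologized via $\bar{\mathrm{d}}_r$ on the families; $\mathrm{SRT}^r_k(\mathbb{S}^1)$ is the set of those having a neighborhood of maps with a dense orbit. Strong leaves: $W^{ss}(\omega,x)=\bigcup_{n\geq0}\Phi^{-n}(W^s_{loc}(\tau^n\omega)\times\{f^n_\omega(x)\})$,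 $W^{uu}(\omega,x)=\bigcup_{n\geq0}\Phi^n(W^u_{loc}(\tau^{-n}\omega)\times\{f^{-n}_\omega(x)\})$, with $W^s_{loc}(\omega)$ (resp. $W^u_{loc}(\omega)$) the set of sequences agreeing with $\omega$ at indices $i\geq0$ (resp. $i<0$), and $\Phi^n(\omega,x)=(\tau^n\omega,f^n_\omega(x))$. $\mathcal{F}^{uu},\mathcal{F}^{ss}$ are the collections of these leaves; minimal means every leaf dense. *)

(* Defs.v *)
From HB Require Import structures.
From mathcomp Require Import all_boot all_order all_algebra all_fingroup.
From mathcomp Require Import all_classical all_reals all_analysis.
Set Implicit Arguments. Unset Strict Implicit. Unset Printing Implicit Defensive.
Import Order.TTheory GRing.Theory Num.Theory.
Import numFieldNormedType.Exports.
Local Open Scope ring_scope.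
Local Open Scope classical_set_scope.

Inductive regularity := Fin of nat | Inf.

Section Defs.
Variable R : realType.

Fixpoint Cn (n : nat) (f : R -> R) : Prop :=
  match n with
  | 0 => continuous f
  | n.+1 => (forall x : R, derivable f x 1) /\ Cn n (derive1 f)
  end.

Definition Cr (r : regularity) (f : R -> R) : Prop :=
  match r with Fin n => Cn n f | Inf => forall n, Cn n f end.

(* ---- Circle S^1 = R/Z, handled through lifts ---- *)
Definition eqmod1 (a b : R) : Prop := exists m : int, a - b = m%:~R.
Definition circ_dist_le (a b d : R) : Prop := exists m : int, `|a - b - m%:~R| <= d.
Definition circ_dist_lt (a b d : R) : Prop := exists m : int, `|a - b - m%:~R| < d.

(* An orientation preserving circle diffeomorphism, given by a lift and the lift
   of its inverse. *)
Record cmap := CMap { lift : R -> R ; ilift : R -> R }.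

Definition is_circ_diffeo (r : regularity) (f : cmap) : Prop :=
  [/\ (forall x, lift f (x + 1) = lift f x + 1),
      cancel (lift f) (ilift f), cancel (ilift f) (lift f),
      (forall x y, x < y -> lift f x < lift f y) &
      Cr r (lift f) /\ Cr r (ilift f)].

Definition pt_le (j : nat) (f g : cmap) (x d : R) : Prop :=
  if j is 0 then circ_dist_le (lift f x) (lift g x) d
  else `|derive1n j (lift f) x - derive1n j (lift g) x| <= d.

(* d_r(f,g) <= d.  For finite r: d_r = max_{0<=j<=r} sup_x (discrepancy of order j).
   For r = oo: d_oo = sup_j 2^-j min(1, d_j). *)
Definition dr_le (r : regularity) (f g : cmap) (d : R) : Prop :=
  match r with
  | Fin n => forall j x, (j <= n)%N -> pt_le j f g x d
  | Inf => forall j x, 1 <= 2 ^+ j * d \/ pt_le j f g x (2 ^+ j * d)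
  end.

Definition dbar_lt (r : regularity) (k : nat) (F G : 'I_k -> cmap) (eps : R) : Prop :=
  exists (s : 'S_k) (d : 'I_k -> R),
    \sum_(i < k) d i < eps /\ forall i, 0 <= d i /\ dr_le r (F i) (G (s i)) (d i).

Definition Sigma (k : nat) := int -> 'I_k.
Definition shift k (w : Sigma k) : Sigma k := fun i => w (i + 1).
Definition ishift k (w : Sigma k) : Sigma k := fun i => w (i - 1).

(* Phi = tau |x F and its inverse, acting on Sigma_k x R (R = lifts of S^1) *)
Definition Phi k (F : 'I_k -> cmap) (p : Sigma k * R) : Sigma k * R :=
  (shift p.1, lift (F (p.1 0)) p.2).
Definition Phiinv k (F : 'I_k -> cmap) (p : Sigma k * R) : Sigma k * R :=
  (ishift p.1, ilift (F (p.1 (-1))) p.2).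

Definition samept k (p q : Sigma k * R) : Prop := p.1 = q.1 /\ eqmod1 p.2 q.2.

Definition near_pt k (m : nat) (eps : R) (p q : Sigma k * R) : Prop :=
  (forall i : int, `|i| <= m%:Z -> p.1 i = q.1 i) /\ circ_dist_lt p.2 q.2 eps.

Definition dense_set k (S : set (Sigma k * R)) : Prop :=
  forall (q : Sigma k * R) (m : nat) (eps : R), 0 < eps ->
    exists s, S s /\ near_pt m eps s q.

Definition has_dense_orbit k (F : 'I_k -> cmap) : Prop :=
  exists p : Sigma k * R, dense_set [set q | exists n : nat, q = iter n (Phi F) p].

Definition SRT (r : regularity) k (F : 'I_k -> cmap) : Prop :=
  (forall i, is_circ_diffeo r (F i)) /\
  exists eps : R, 0 < eps /\
    forall G : 'I_k -> cmap, (forall i, is_circ_diffeo r (G i)) ->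
      dbar_lt r F G eps -> has_dense_orbit G.

(* strong stable leaf W^ss(p) = U_n Phi^-n (W^s_loc(tau^n w) x {f^n_w(x)}) *)
Definition Wss k (F : 'I_k -> cmap) (p : Sigma k * R) : set (Sigma k * R) :=
  [set q | exists n : nat,
     (forall i : int, 0 <= i -> (iter n (Phi F) q).1 i = (iter n (Phi F) p).1 i)
     /\ eqmod1 (iter n (Phi F) q).2 (iter n (Phi F) p).2].

(* strong unstable leaf W^uu(p) = U_n Phi^n (W^u_loc(tau^-n w) x {f^-n_w(x)}) *)
Definition Wuu k (F : 'I_k -> cmap) (p : Sigma k * R) : set (Sigma k * R) :=
  [set q | exists (n : nat) (z : Sigma k * R),
     (forall i : int, i < 0 -> z.1 i = (iter n (Phiinv F) p).1 i)
     /\ eqmod1 z.2 (iter n (Phiinv F) p).2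
     /\ samept q (iter n (Phi F) z)].

Definition minimal_ss k (F : 'I_k -> cmap) : Prop := forall p, dense_set (Wss F p).
Definition minimal_uu k (F : 'I_k -> cmap) : Prop := forall p, dense_set (Wuu F p).

End Defs.

Definition reg_ge1 (r : regularity) : Prop :=
  match r with Fin n => (1 <= n)%N | Inf => True end.

(* Main.v *)
Require Import Defs.
From HB Require Import structures.
From mathcomp Require Import all_boot all_order all_algebra all_fingroup.
From mathcomp Require Import all_classical all_reals all_analysis.
From mathcomp Require Import ring lra zify.
Import Defs.
Set Implicit Arguments. Unset Strict Implicit. Unset Printing Implicit Defensive.
Import Order.TTheory GRing.Theory Num.Theory.
Import numFieldNormedType.Exports.
Local Open Scope ring_scope.
Local Open Scope classical_set_scope.

(* Robust transitivity: if every short arc is expanded by the inverse of some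
   generator, then, for every C^1-small perturbation, each arc contains the image
   under a word of an arc of a fixed length delta.  It remains to connect arcs of
   length delta, which takes words of bounded length and is therefore robust.

   Psi has the generators x + c sin 2 pi x, x + c (1 - cos 2 pi x) and their inverses.
   At every point one of them expands and one of them contracts, while the common
   fixed point 0 makes the strong leaves through it non-dense.

   The generators of Phi are inverses of diffeomorphisms h which map into itself the
   Cantor set K of the points whose orbit under tripling avoids the open middle gaps.
   Apart from the rotation by 1/3 and the identity, each h has the form 3 x + const on
   an arc, and the arcs cover the circle.  Since h(K) is contained in K,
   a strong stable leaf starting in K stays in K.  On the other hand the generators
   realize all inverse branches of tripling up to rotation by 1/3, so that every
   forward orbit of the semigroup is dense; this gives the minimality of the strong
   unstable foliation and the robust transitivity. *)

(** * Differential calculus of C^n functions *)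

Section Smoothness.
Variable R : realType.
Implicit Types (f g df dg : R -> R) (n : nat).

Lemma CnS_intro n f df :
  (forall x : R, is_derive x 1 f (df x)) -> Cn n df -> Cn n.+1 f.
Proof.
move=> fdf Cdf; split; first by move=> x; apply: ex_derive.
suff -> : derive1 f = df by [].
by apply/funext => x; rewrite derive1E derive_val.
Qed.

Lemma CnS_elim n f : Cn n.+1 f ->
  (forall x : R, is_derive x 1 f (derive1 f x)) /\ Cn n (derive1 f).
Proof.
move=> [df Cf]; split=> // x.
by rewrite derive1E; apply: DeriveDef.
Qed.

Lemma is_derive_continuous f df :
  (forall x : R, is_derive x 1 f (df x)) -> continuous f.
Proof.
move=> fdf x; apply/differentiable_continuous/derivable1_diffP.
exact: (@ex_derive _ _ _ _ _ _ _ (fdf x)).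
Qed.

Lemma Cn_continuous n f : Cn n f -> continuous f.
Proof.
case: n => // n /CnS_elim[fdf _]; exact: is_derive_continuous fdf.
Qed.

Lemma Cn_le n m f : (n <= m)%N -> Cn m f -> Cn n f.
Proof.
elim: n m f => [m f _|n IH [//|m] f nm]; first exact: Cn_continuous.
by move=> [df Cf]; split=> //; apply: IH Cf.
Qed.

Lemma Cn_cst n (c : R) : Cn n (fun=> c).
Proof.
elim: n c => [|n IH] c; first by move=> x; apply: cst_continuous.
by apply: (CnS_intro (df := fun=> 0)).
Qed.

Lemma Cn_id n : Cn n (fun x : R => x).
Proof.
case: n => [|n]; first by move=> x.
by apply: (CnS_intro (df := fun=> 1)); exact: Cn_cst.
Qed.

Lemma CnD n f g : Cn n f -> Cn n g -> Cn n (fun x => f x + g x).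
Proof.
elim: n f g => [|n IH] f g; first by move=> cf cg x; apply: cvgD; [exact: cf|exact: cg].
move=> /CnS_elim[fd Cf] /CnS_elim[gd Cg].
by apply: (CnS_intro (df := fun x => derive1 f x + derive1 g x)); exact: IH.
Qed.

Lemma CnM n f g : Cn n f -> Cn n g -> Cn n (fun x => f x * g x).
Proof.
elim: n f g => [|n IH] f g; first by move=> cf cg x; apply: cvgM; [exact: cf|exact: cg].
move=> Cf' Cg'; move: (Cf') (Cg') => /CnS_elim[fd Cf] /CnS_elim[gd Cg].
apply: (CnS_intro (df := fun x => f x * derive1 g x + g x * derive1 f x)).
by apply: CnD; apply: IH => //; [move: Cf'|move: Cg']; apply: Cn_le.
Qed.

Lemma Cn_comp n f g : Cn n f -> Cn n g -> Cn n (fun x => f (g x)).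
Proof.
elim: n f g => [|n IH] f g.
  by move=> cf cg x; apply: (@continuous_comp _ _ _ g f); [exact: cg|exact: cf].
move=> Cf' Cg'; move: (Cf') (Cg') => /CnS_elim[fd Cf] /CnS_elim[gd Cg].
have D (x : R) : is_derive x 1 (fun x => f (g x)) (derive1 f (g x) * derive1 g x).
  exact: (@is_derive1_comp _ f g).
apply: (CnS_intro D).
by apply: CnM => //; apply: IH => //; move: Cg'; apply: Cn_le.
Qed.

Lemma CnV n f : (forall x, f x != 0) -> Cn n f -> Cn n (fun x => (f x)^-1).
Proof.
move=> f0; elim: n => [|n IH]; first by move=> cf x; apply: cvgV; [exact: f0|exact: cf].
move=> Cf'; move: (Cf') => /CnS_elim[fd Cf].
have D (x : R) : is_derive x 1 (fun x => (f x)^-1) ((- (1)) * (((f x)^-1 * (f x)^-1) * derive1 f x)).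
  apply: (is_derive_eq (is_deriveV (f0 x) (fd x))).
  by rewrite /GRing.scale /= mulN1r mulNr -exprVn expr2.
apply: (CnS_intro D).
have CV : Cn n (fun x => (f x)^-1) by apply: IH; move: Cf'; apply: Cn_le.
by apply: CnM; [exact: Cn_cst|apply: CnM => //; apply: CnM].
Qed.

(** Differentiation is local, and [near_join] turns agreement near x into agreement near every y
    close to x, so the induction passes to the derivatives. It serves [tripling], which is glued
    from formulas on unit intervals. *)
Lemma Cn_near n f : (forall x : R, exists2 g, Cn n g & \forall y \near x, f y = g y) ->
  Cn n f.
Proof.
elim: n f => [|n IH] f H.
  move=> x; have [g Cg fg] := H x.
  have gx := nbhs_singleton fg.
  rewrite /continuous_at gx; apply: cvg_trans (Cg x).
  by apply: near_eq_cvg; near=> y; rewrite /=; symmetry; near: y.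
have fd (x : R) : is_derive x 1 f (derive1 f x).
  have [g /CnS_elim[gd _] fg] := H x.
  suff D : is_derive x 1 f (derive1 g x).
    by rewrite derive1E (@derive_val _ _ _ _ _ _ _ D).
  apply: near_eq_is_derive (gd x).
  by near=> y; symmetry; near: y.
apply: (CnS_intro fd); apply: IH => x.
have [g /CnS_elim[gd Cg] fg] := H x.
exists (derive1 g) => //.
have := near_join fg; apply: filterS => y fgy.
have D : is_derive y 1 f (derive1 g y).
  apply: near_eq_is_derive (gd y).
  by near=> z; symmetry; near: z.
by rewrite derive1E (@derive_val _ _ _ _ _ _ _ D).
Unshelve. all: by end_near.
Qed.

(** Since g' = 1 / f'(g), order n for g gives order n + 1: a bootstrap starting from the continuity
    of g. *)
Lemma Cn_inverse n f g : cancel f g -> cancel g f -> continuous g ->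
  (forall x, derive1 f x != 0) -> Cn n f -> Cn n g.
Proof.
move=> fg gf cg f0; elim: n => [|n IH] // Cf'; move: (Cf') => /CnS_elim[fd Cf].
have D (x : R) : is_derive x 1 g (derive1 f (g x))^-1.
  have := @is_derive_inverse _ f g _ (g x) _ _ (fd (g x)) (f0 _).
  rewrite gf; apply; first by apply: (@filterE _ (nbhs (g x))) => y; exact: fg.
  by apply: (@filterE _ (nbhs (g x))) => y; exact: (is_derive_continuous fd).
apply: (CnS_intro D).
apply: CnV => [x|]; first exact: f0.
by apply: Cn_comp => //; apply: IH; move: Cf'; apply: Cn_le.
Qed.

Lemma mean_value f df (a b : R) : (forall x : R, is_derive x 1 f (df x)) -> a <= b ->
  exists2 c, a <= c <= b & f b - f a = df c * (b - a).
Proof.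
move=> fd ab.
have fc : {within `[a, b], continuous f}.
  exact/continuous_subspaceT/(is_derive_continuous fd).
have [c cab E] := MVT_segment ab (fun x _ => fd x) fc.
by exists c => //; move: cab; rewrite in_itv.
Qed.

End Smoothness.

(** * A smooth step function *)

Section SmoothStep.
Variable R : realType.

(** The powers of 1/x make the family closed under differentiation, up to linear combinations, so
    that all members are proved smooth at once. *)
Definition flat_exp (n : nat) (x : R) : R :=
  if 0 < x then x^-1 ^+ n * expR (- x^-1) else 0.

Lemma flat_exp_ge0 n x : 0 <= flat_exp n x.
Proof.
rewrite /flat_exp; case: ifPn => // x0.
by rewrite mulr_ge0 ?expR_ge0// exprn_ge0// invr_ge0 ltW.
Qed.

(** With u = 1/x, the exponential series gives e^u >= u^(n+1) / (n+1)!, so u^n e^(-u) is at most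
    (n+1)! x. This yields continuity at 0. *)
Lemma flat_exp_le n x : flat_exp n x <= n.+1`!%:R * `|x|.
Proof.
rewrite /flat_exp; case: ifPn => [x0|_]; last by rewrite mulr_ge0.
have u0 : 0 < x^-1 by rewrite invr_gt0.
have E := @expR_ge1Dxn _ x^-1 n (ltW u0).
have F0 : 0 < n.+1`!%:R :> R by rewrite ltr0n fact_gt0.
have {E} : x^-1 ^+ n.+1 <= n.+1`!%:R * expR (x^-1).
  rewrite -ler_pdivrMl// mulrC; apply: le_trans E.
  by rewrite lerDr ler01.
rewrite gtr0_norm// expRN exprS => E.
rewrite ler_pdivrMr ?expR_gt0// -(ler_pM2l u0) (le_trans E)//.
suff -> : x^-1 * (n.+1`!%:R * x * expR x^-1) = n.+1`!%:R * expR x^-1 by [].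
by field; rewrite gt_eqF.
Qed.

Lemma flat_exp_continuous0 n : {for 0, continuous (flat_exp n)}.
Proof.
have F0 : flat_exp n 0 = 0 by rewrite /flat_exp ltxx.
rewrite /prop_for /continuous_at F0.
apply: (@squeeze_cvgr _ _ _ _ (fun=> 0) (fun x => n.+1`!%:R * `|x|)).
- by apply: (@filterE _ (nbhs (0 : R))) => y; rewrite flat_exp_ge0 flat_exp_le.
- exact: cvg_cst.
- rewrite -[X in _ --> X](mulr0 n.+1`!%:R); apply: cvgM; first exact: cvg_cst.
  by rewrite -[X in _ --> X](@normr0 R R); apply: cvg_norm; exact: cvg_id.
Qed.

Lemma is_derive_flat_exp n (x : R) :
  is_derive x 1 (flat_exp n) (- n%:R * flat_exp n.+1 x + flat_exp n.+2 x).
Proof.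
have [x0|x0|<-] := ltgtP 0 x.
- rewrite /flat_exp x0.
  have I : is_derive x 1 (fun y : R => y^-1) (- x ^- 2).
    apply: (is_derive_eq (is_deriveV (lt0r_neq0 x0) (is_derive_id x 1))).
    by rewrite /GRing.scale /= mulr1.
  have D : is_derive x 1 (fun y : R => y^-1 ^+ n * expR (- y^-1))
     (- n%:R * (x^-1 ^+ n.+1 * expR (- x^-1)) + x^-1 ^+ n.+2 * expR (- x^-1)).
    have P : is_derive x 1 (fun y : R => y^-1 ^+ n) (- n%:R * x^-1 ^+ n.+1).
      elim: n => [|n IH]; first by rewrite oppr0 mul0r; exact: is_derive_cst.
      have -> : (fun y : R => y^-1 ^+ n.+1) = (fun y : R => y^-1 * y^-1 ^+ n).
        by apply/funext => y; rewrite exprS.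
      apply: (is_derive_eq (is_deriveM I IH)).
      by rewrite /GRing.scale /= -exprVn -natr1 !exprS expr0; ring.
    have N : is_derive x 1 (fun y : R => - y^-1) (- - x ^- 2) by exact: is_deriveN.
    have E := @is_derive1_comp _ expR (fun y => - y^-1) x _ _ (is_derive_expR _) N.
    apply: (is_derive_eq (is_deriveM P E)).
    by rewrite /GRing.scale /= -exprVn !exprS expr0; ring.
  apply: near_eq_is_derive D.
  near=> y; rewrite ifT//; near: y.
  exact: lt_nbhsr.
- rewrite /flat_exp ![in X in is_derive _ _ _ X]ltNge (ltW x0)/= mulr0 addr0.
  apply: (near_eq_is_derive (f := fun=> 0)).
  near=> y; rewrite ifF//; apply/negbTE; rewrite -leNgt ltW//; near: y.
  exact: lt_nbhsl.
- rewrite {2 3}/flat_exp ltxx mulr0 addr0.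
  (* Dividing by z raises the index: the slope of [flat_exp n] at 0 is [flat_exp n.+1], continuous
     there with value 0. *)
  apply/is_derive1_caratheodory; exists (flat_exp n.+1); split.
  + move=> z; rewrite {2}/flat_exp ltxx !subr0 /flat_exp.
    case: ifPn => [z0|]; last by rewrite mul0r.
    by rewrite exprS mulrAC [z^-1 * _]mulrC mulfVK// gt_eqF.
  + exact: flat_exp_continuous0.
  + by rewrite /flat_exp ltxx.
Unshelve. all: by end_near.
Qed.

Lemma Cn_flat_exp n m : Cn n (flat_exp m).
Proof.
elim: n m => [|n IH] m; first exact: is_derive_continuous (is_derive_flat_exp m).
apply: (CnS_intro (is_derive_flat_exp m)).
by apply: CnD => //; apply: CnM => //; exact: Cn_cst.
Qed.

Definition smooth_step (x : R) : R :=
  flat_exp 0 x / (flat_exp 0 x + flat_exp 0 (1 - x)).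

Lemma flat_exp_gt0 n x : 0 < x -> 0 < flat_exp n x.
Proof.
by move=> x0; rewrite /flat_exp x0 mulr_gt0 ?expR_gt0// exprn_gt0// invr_gt0.
Qed.

Lemma smooth_step_den_gt0 x : 0 < flat_exp 0 x + flat_exp 0 (1 - x).
Proof.
have [x0|x0] := ltP 0 x; first by rewrite ltr_wpDr ?flat_exp_ge0 ?flat_exp_gt0.
by rewrite ltr_wpDl ?flat_exp_ge0// flat_exp_gt0//; lra.
Qed.

Lemma smooth_step0 x : x <= 0 -> smooth_step x = 0.
Proof. by move=> x0; rewrite /smooth_step {1}/flat_exp ltNge x0 mul0r. Qed.

Lemma smooth_step1 x : 1 <= x -> smooth_step x = 1.
Proof.
move=> x1; have := smooth_step_den_gt0 x; rewrite /smooth_step.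
rewrite [flat_exp 0 (1 - x)]/flat_exp ifF ?addr0; last by apply/negbTE; rewrite -leNgt; lra.
by move=> H; rewrite divff ?gt_eqF.
Qed.

Lemma smooth_step_bounds x : 0 <= smooth_step x <= 1.
Proof.
rewrite /smooth_step divr_ge0 ?flat_exp_ge0 ?(ltW (smooth_step_den_gt0 x))//=.
by rewrite ler_pdivrMr ?smooth_step_den_gt0// mul1r lerDl flat_exp_ge0.
Qed.

Lemma Cn_affine n (p q : R) : Cn n (fun x => p * x + q).
Proof.
by apply: CnD; [apply: CnM; [exact: Cn_cst|exact: Cn_id]|exact: Cn_cst].
Qed.

Lemma Cn_smooth_step n : Cn n smooth_step.
Proof.
have C1 : Cn n (fun x => flat_exp 0 (1 - x)).
  have -> : (fun x => flat_exp 0 (1 - x)) = (fun x => flat_exp 0 (- 1 * x + 1)).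
    by apply/funext => x; congr flat_exp; ring.
  by apply: (Cn_comp (f := flat_exp 0)); [exact: Cn_flat_exp|exact: Cn_affine].
apply: CnM; first exact: Cn_flat_exp.
apply: CnV => [x|]; first by rewrite gt_eqF// smooth_step_den_gt0.
by apply: CnD => //; exact: Cn_flat_exp.
Qed.

Lemma smooth_step_derive_ge0 x : 0 <= derive1 smooth_step x.
Proof.
have Dl : is_derive x 1 (fun y : R => 1 - y) (-1).
  by apply: (is_derive_eq (is_deriveB (is_derive_cst (1 : R) x 1) (is_derive_id x 1))); rewrite sub0r.
have D1 := @is_derive1_comp _ (flat_exp 0) (fun y => 1 - y) x _ _
  (is_derive_flat_exp 0 (1 - x)) Dl.
have D2 := is_deriveD (is_derive_flat_exp 0 x) D1.
have D3 := @is_deriveV _ (flat_exp 0 + (flat_exp 0 \o (fun y => 1 - y))) x _ 1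
  (lt0r_neq0 (smooth_step_den_gt0 x)) D2.
have D := is_deriveM (is_derive_flat_exp 0 x) D3.
have d0 := smooth_step_den_gt0 x.
(* In the quotient rule the two products of [flat_exp 0 x] with its own derivative cancel, and only
   nonnegative terms remain. *)
have E : is_derive x 1 smooth_step ((flat_exp 0 x * flat_exp 2 (1 - x)
    + flat_exp 0 (1 - x) * flat_exp 2 x) * (flat_exp 0 x + flat_exp 0 (1 - x)) ^- 2).
  apply: (is_derive_eq D); rewrite /GRing.scale /= !fctE /= !oppr0 !mul0r !add0r.
  by field; rewrite gt_eqF.
rewrite derive1E (@derive_val _ _ _ _ _ _ _ E).
apply: mulr_ge0; first by rewrite addr_ge0 ?mulr_ge0 ?flat_exp_ge0.
by rewrite invr_ge0 exprn_ge0// ltW.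
Qed.

End SmoothStep.

(** * Lifts of circle maps, words and dense orbits *)

Section CircleLifts.
Variable R : realType.
Implicit Types (f g : R -> R).

Definition degree_one f := forall x, f (x + 1) = f x + 1.

Lemma degree_one_int f (m : int) x : degree_one f -> f (x + m%:~R) = f x + m%:~R.
Proof.
move=> f1.
have N (n : nat) y : f (y + n%:R) = f y + n%:R.
  by elim: n => [|n IH]; rewrite ?addr0// -natr1 !addrA f1 IH.
case: m => n; first exact: N.
rewrite NegzE mulrNz -[in RHS](subrK (n.+1%:R) x) -[X in _ = f X + _]/(x - n.+1%:R + n.+1%:R).
by rewrite N addrK.
Qed.

Definition inverse_lift f (y : R) : R := xget 0 [set x | f x = y].

(** Positivity of the derivative gives injectivity; degree one brackets any y between the values at
    two consecutive integers, hence surjectivity. Both directions are recorded because inverses also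
    occur as generators. *)
Lemma inverse_lift_diffeo f : (forall n, Cn n f) -> degree_one f ->
  (forall x, 0 < derive1 f x) ->
  forall r, is_circ_diffeo r (CMap f (inverse_lift f)) /\
            is_circ_diffeo r (CMap (inverse_lift f) f).
Proof.
move=> Cf f1 f'0.
have [fd _] := CnS_elim (Cf 1%N).
have cf := is_derive_continuous fd.
have mf x y : x < y -> f x < f y.
  move=> xy; have [c _ E] := mean_value fd (ltW xy).
  by rewrite -subr_gt0 E mulr_gt0// subr_gt0.
have injf : injective f.
  by move=> x y E; have [/mf|/mf|//] := ltgtP x y; rewrite E ltxx.
have sf y : exists x, f x = y.
  pose m := Num.floor (y - f 0).
  have /andP[m1 m2] := floor_itv (y - f 0).
  have E (n : int) : f n%:~R = f 0 + n%:~R by rewrite -[n%:~R]add0r degree_one_int// add0r.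
  have [|||c _ fc] := @IVT R f m%:~R (m + 1)%:~R y; last by exists c.
  - by rewrite ler_int lerDl.
  - exact: continuous_subspaceT.
  - rewrite !E ge_min le_max; apply/andP; split; apply/orP; [left|right].
      by rewrite -lerBrDl.
    by rewrite -lerBlDl ltW.
have gK : cancel (inverse_lift f) f.
  by move=> y; rewrite /inverse_lift; case: xgetP => [x _ ->//|no]; have [x /no] := sf y.
have fK : cancel f (inverse_lift f) by move=> x; apply: injf; rewrite gK.
have g1 : degree_one (inverse_lift f) by move=> x; apply: injf; rewrite f1 !gK.
have mg x y : x < y -> inverse_lift f x < inverse_lift f y.
  by move=> xy; rewrite ltNge le_eqVlt; apply/negP => /orP[/eqP/(congr1 f)|/mf];
    rewrite !gK => H; move: xy; rewrite ?H ?ltxx// => /(lt_trans H); rewrite ltxx.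
have cg : continuous (inverse_lift f).
  move=> y; rewrite -(gK y); apply: (nbhs_singleton (near_can_continuous (f := f) _ _)).
  - by apply: (@filterE _ (nbhs (inverse_lift f y))) => z; exact: fK.
  - by apply: (@filterE _ (nbhs (inverse_lift f y))) => z; exact: cf.
have Cg n : Cn n (inverse_lift f).
  by apply: (Cn_inverse fK gK cg) => // x; rewrite gt_eqF.
by move=> [n|]; split; split=> //; split.
Qed.

End CircleLifts.

(** * Words of generators and a dense orbit of the skew-product *)

Section Words.
Variables (R : realType) (k : nat) (F : 'I_k -> cmap R).

Definition wcomp (a : seq 'I_k) (x : R) : R := foldl (fun x i => lift (F i) x) x a.

Lemma wcomp_cat a b x : wcomp (a ++ b) x = wcomp b (wcomp a x).
Proof. exact: foldl_cat. Qed.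

Lemma iter_Phi n (p : Sigma k * R) :
  iter n (Phi F) p = (fun i => p.1 (i + n%:Z), wcomp (mkseq (fun j => p.1 j%:Z) n) p.2).
Proof.
elim: n => [|n IH]; first by case: p => w x; congr pair; apply/funext => i; rewrite addr0.
rewrite iterS IH mkseqS /Phi /shift /wcomp foldl_rcons /= add0r; congr pair.
by apply/funext => i; rewrite -addrA -intS.
Qed.

Hypothesis Fdiff : exists r, forall i, is_circ_diffeo r (F i).

Lemma wcomp_int a (m : int) x : wcomp a (x + m%:~R) = wcomp a x + m%:~R.
Proof.
have [r Fd] := Fdiff.
elim: a x => // i a IH x; rewrite /wcomp/= -/(wcomp _ _) degree_one_int//.
by have [] := Fd i.
Qed.

Lemma wcomp_lt a x y : x < y -> wcomp a x < wcomp a y.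
Proof.
have [r Fd] := Fdiff.
by elim: a x y => //= i a IH x y xy; apply: IH; have [_ _ _ H _] := Fd i; exact: H.
Qed.

Lemma wcomp_ltE a x y : (wcomp a x < wcomp a y) = (x < y).
Proof. by apply: leW_mono; apply: le_mono; exact: wcomp_lt. Qed.

Lemma wcomp_surj a y : exists x, wcomp a x = y.
Proof.
have [r Fd] := Fdiff.
elim: a y => [|i a IH] y; first by exists y.
have [x <-] := IH y; exists (ilift (F i) x).
by rewrite /wcomp/=; have [_ _ -> _ _] := Fd i.
Qed.

Definition transitive_ifs := forall u1 u2 v1 v2 : R, u1 < u2 -> v1 < v2 ->
  exists a x (m : int), u1 < x < u2 /\ v1 < wcomp a x + m%:~R < v2.

(* A state is a word already read and an interval of starting points.  A target
   (l, h, c, e) asks for the word l to be read around a time, h letters after its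
   beginning, at which the orbit is within 1 / (e + 1) of c. *)
Let state := (seq 'I_k * (R * R))%type.
Let target := (seq 'I_k * nat * rat * nat)%type.

(** The trailing letter [i0] lengthens the word at every step, so that the words converge to an
    infinite sequence. The estimate is asked on the closed interval, where the limit point will be
    located. *)
Let step_ok (i0 : 'I_k) (s : state) (t : target) (s' : state) :=
  let: (l, h, c, e) := t in
  exists a, [/\ s'.1 = s.1 ++ a ++ l ++ [:: i0],
     s.2.1 < s'.2.1, s'.2.1 < s'.2.2, s'.2.2 < s.2.2 &
     forall x, s'.2.1 <= x <= s'.2.2 -> exists m : int,
       `|wcomp (s.1 ++ a ++ take h l) x - ratr c - m%:~R| < e.+1%:R^-1].

(** Transitivity is applied between the image of the interval under the word already read and the
    preimage of the target ball under the first h letters. By monotonicity the good starting points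
    form an interval around [x0], whose ends are moved halfway towards [x0]. *)
Let step_exists i0 : transitive_ifs -> forall s t, s.2.1 < s.2.2 -> exists s', step_ok i0 s t s'.
Proof.
move=> tr [u [p q]] [[[l h] c] e] /= pq.
have e0 : 0 < (e.+1%:R^-1 : R) by rewrite invr_gt0 ltr0n.
set ee := (_^-1 : R) in e0 *.
have [v1 E1] := wcomp_surj (take h l) (ratr c - ee).
have [v2 E2] := wcomp_surj (take h l) (ratr c + ee).
have v12 : v1 < v2 by rewrite -(wcomp_ltE (take h l)) E1 E2; lra.
have upq : wcomp u p < wcomp u q by exact: wcomp_lt.
have [a [x [m [/andP[ux xu] /andP[vx xv]]]]] := tr _ _ _ _ upq v12.
have [x0 Ex0] := wcomp_surj u x.
move: ux xu; rewrite -Ex0 !wcomp_ltE => px0 x0q.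
pose g := wcomp (u ++ a ++ take h l).
have gx0 : g x0 = wcomp (take h l) (wcomp a x) by rewrite /g !wcomp_cat Ex0.
have {vx} : ratr c - ee < g x0 + m%:~R by rewrite gx0 -wcomp_int -E1; exact: wcomp_lt.
have {xv} : g x0 + m%:~R < ratr c + ee by rewrite gx0 -wcomp_int -E2; exact: wcomp_lt.
have [yl Eyl] := wcomp_surj (u ++ a ++ take h l) (ratr c - ee - m%:~R).
have [yr Eyr] := wcomp_surj (u ++ a ++ take h l) (ratr c + ee - m%:~R).
move=> gr gl.
have ylx : yl < x0 by rewrite -(wcomp_ltE (u ++ a ++ take h l)) Eyl -/g ltrBlDr.
have xyr : x0 < yr by rewrite -(wcomp_ltE (u ++ a ++ take h l)) Eyr -/g ltrBrDr.
pose p' := (Num.max p yl + x0) / 2; pose q' := (x0 + Num.min q yr) / 2.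
have M1 : Num.max p yl < x0 by rewrite gt_max px0.
have M2 : x0 < Num.min q yr by rewrite lt_min x0q.
have [Mp My] : p <= Num.max p yl /\ yl <= Num.max p yl by rewrite !le_max !lexx orbT.
have [Nq Ny] : Num.min q yr <= q /\ Num.min q yr <= yr by rewrite !ge_min !lexx orbT.
exists (u ++ a ++ l ++ [:: i0], (p', q')); exists a; split=> //=; rewrite /p' /q'.
- lra.
- lra.
- lra.
move=> y /andP[y1 y2]; exists (- m).
have : wcomp (u ++ a ++ take h l) yl < wcomp (u ++ a ++ take h l) y by apply: wcomp_lt; lra.
have : wcomp (u ++ a ++ take h l) y < wcomp (u ++ a ++ take h l) yr by apply: wcomp_lt; lra.
rewrite Eyl Eyr mulrNz => H1 H2; rewrite ltr_norml; apply/andP; split; lra.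
Qed.

(** All targets are met one after the other along nested intervals; the limit of the words and the
    common point of the intervals start a dense orbit. *)
Lemma transitive_dense_orbit : 'I_k -> transitive_ifs -> has_dense_orbit F.
Proof.
move=> i0 tr.
have /choice[stp stpP] : forall st : state * target, exists s',
    st.1.2.1 < st.1.2.2 -> step_ok i0 st.1 st.2 s'.
  move=> [s t]; have [st|] := boolP (s.2.1 < s.2.2); last by exists s.
  by have [s' ?] := step_exists i0 tr t st; exists s'.
pose t0 : target := ([::], 0%N, 0, 0%N).
(* Targets are served in the order of their codes; a number that codes nothing gets the trivial
   target [t0]. *)
pose S := fix S n : state := if n is m.+1 then stp (S m, odflt t0 (unpickle m))
                             else ([::], (0, 1)).
have Spq n : (S n).2.1 < (S n).2.2.
  elim: n => [|n IH] /=; first exact: ltr01.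
  have := stpP (S n, odflt t0 (unpickle n)) IH.
  by case: (odflt _ _) => [[[l h] c] e] /= [a []].
have SS n : step_ok i0 (S n) (odflt t0 (unpickle n)) (S n.+1) by exact: (stpP (S n, odflt t0 (unpickle n)) (Spq n)).
clearbody S.
have Sw n : exists2 v, (S n.+1).1 = (S n).1 ++ v & (0 < size v)%N.
  have := SS n; case: (odflt _ _) => [[[l h] c] e] [a [-> _ _ _ _]].
  by exists (a ++ l ++ [:: i0]) => //; rewrite !size_cat /= addnA addn1.
have Ssize n : (n <= size (S n).1)%N.
  elim: n => // n IH; have [v -> v0] := Sw n.
  by rewrite size_cat -addn1 leq_add.
have Spre n m : (n <= m)%N -> exists v, (S m).1 = (S n).1 ++ v.
  elim: m => [|m IH]; first by rewrite leqn0 => /eqP ->; exists [::]; rewrite cats0.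
  rewrite leq_eqVlt => /orP[/eqP ->|/IH[v Ev]]; first by exists [::]; rewrite cats0.
  by have [v' -> _] := Sw m; exists (v ++ v'); rewrite Ev catA.
have Slt n : (S n).2.1 < (S n.+1).2.1 /\ (S n.+1).2.2 < (S n).2.2.
  by have := SS n; case: (odflt _ _) => [[[l h] c] e] [a [_ ? _ ? _]].
have Smono n m : (n <= m)%N -> (S n).2.1 <= (S m).2.1 /\ (S m).2.2 <= (S n).2.2.
  elim: m => [|m IH]; first by rewrite leqn0 => /eqP ->.
  rewrite leq_eqVlt => /orP[/eqP ->|/IH[H1 H2]]; first by [].
  by have [H3 H4] := Slt m; split; [apply: le_trans (ltW H3)|apply: le_trans H2; exact: ltW].
have Spm n m : (S n).2.1 <= (S m).2.2.
  have [/Smono[H _]|/ltnW/Smono[_ H]] := leqP n m.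
    by apply: le_trans H (ltW (Spq m)).
  by apply: le_trans H; exact: ltW.
pose A := [set (S n).2.1 | n in setT].
have supA : has_sup A.
  split; first by exists (S 0%N).2.1, 0%N.
  by exists (S 0%N).2.2 => _ [n _ <-]; exact: Spm.
pose x := sup A.
have Sx n : (S n).2.1 <= x <= (S n).2.2.
  apply/andP; split; first by apply: (ub_le_sup supA.2); exists n.
  by apply: ge_sup; [exact: supA.1|move=> _ [m _ <-]; exact: Spm].
pose w (j : nat) := nth i0 (S j.+1).1 j.
have wE n j : (j < size (S n).1)%N -> w j = nth i0 (S n).1 j.
  move=> jn; rewrite /w; have [/Spre[v ->]|/ltnW/Spre[v ->]] := leqP j.+1 n.
    by rewrite nth_cat Ssize.
  by rewrite nth_cat jn.
(* The past is filled by mirroring the future; this is harmless, since at the time [N] below the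
   window from -m to m only meets nonnegative indices. *)
exists (fun i : int => w `|i|%N, x) => q m eps eps0.
(* The window of q from -m to m has length 2m + 1; after its first m letters coordinate 0 is in
   place. *)
pose l := mkseq (fun j : nat => q.1 (j%:Z - m%:Z)) (m + m.+1).
have [c cq] : exists c : rat, `|ratr c - q.2| < eps / 2.
  have lt1 : q.2 - eps / 2 < q.2 + eps / 2 by lra.
  have [c] := rat_in_itvoo lt1; rewrite in_itv/= => /andP[c1 c2].
  by exists c; rewrite ltr_norml; apply/andP; split; lra.
have [e ee] : exists e : nat, (e.+1%:R^-1 : R) < eps / 2.
  have e2 : 0 < eps / 2 by lra.
  exists (Num.truncn (eps / 2)^-1).
  by rewrite invf_plt ?posrE ?ltr0n// truncnS_gt.
pose t : target := (l, m, c, e).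
have := SS (pickle t); rewrite pickleK /= => -[a [Eu _ _ _ /(_ _ (Sx _))[z zx]]].
set u := (S (pickle t)).1 in Eu zx.
pose N := (size (u ++ a) + m)%N.
have sl : size l = (m + m.+1)%N by rewrite size_mkseq.
have wN j : (j < N + m.+1)%N -> w j = nth i0 ((u ++ a) ++ l) j.
  move=> jN; have js : (j < size ((u ++ a) ++ l))%N by rewrite size_cat sl addnA.
  rewrite (wE (pickle t).+1) Eu catA [_ ++ l ++ _]catA ?nth_cat ?js//.
  by rewrite size_cat (leq_trans js)// leq_addr.
exists (iter N (Phi F) (fun i : int => w `|i|%N, x)); split; first by exists N.
rewrite iter_Phi; split=> /=.
  move=> i; rewrite ler_norml => /andP[i1 i2].
  have [j Ej] : exists j : nat, i = j%:Z - m%:Z.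
    by exists (absz (i + m%:Z)); rewrite gez0_abs ?addrK//; lia.
  have jm : (j < m + m.+1)%N by lia.
  have -> : absz (i + N%:Z) = (size (u ++ a) + j)%N by rewrite /N; lia.
  rewrite wN; last by rewrite /N; lia.
  by rewrite nth_cat ltnNge leq_addr/= addKn nth_mkseq// Ej.
exists z.
have -> : mkseq (fun j : nat => w `|j%:Z|%N) N = u ++ a ++ take m l.
  apply: (@eq_from_nth _ i0); first by rewrite size_mkseq !size_cat size_takel ?sl ?leq_addr// /N size_cat addnA.
  move=> j; rewrite size_mkseq => jN; rewrite nth_mkseq// wN; last by lia.
  rewrite catA !nth_cat; case: ltnP => // H; rewrite nth_take//.
  by move: jN H; rewrite /N; lia.
move: zx cq ee; set W := wcomp _ x; set ei := (e.+1%:R^-1 : R); rewrite !ltr_norml => /andP[z1 z2] /andP[c1 c2] e1.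
by apply/andP; split; lra.
Qed.

End Words.

(** * A criterion for robust transitivity *)

Section Robustness.
Variable R : realType.

Lemma circ_diffeo_is_derive r (f : cmap R) : reg_ge1 r -> is_circ_diffeo r f ->
  forall x : R, is_derive x 1 (lift f) (derive1 (lift f) x).
Proof.
move=> r1 [_ _ _ _ [Cf _]].
suff : Cn 1 (lift f) by move/CnS_elim => [].
by case: r r1 Cf => [n|] r1 Cf; [exact: Cn_le Cf|exact: Cf].
Qed.

Section Perturbation.
Variables (k : nat) (F G : 'I_k -> cmap R) (r : regularity).
Hypothesis r1 : reg_ge1 r.
Hypothesis Fdiff : forall i, is_circ_diffeo r (F i).
Hypothesis Gdiff : forall i, is_circ_diffeo r (G i).

Definition C1_close (e : R) := forall i x,
  circ_dist_le (lift (F i) x) (lift (G i) x) e /\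
  `|derive1 (lift (F i)) x - derive1 (lift (G i)) x| <= e.

Definition lipschitz_ifs (L : R) := forall i x y,
  `|lift (F i) x - lift (F i) y| <= L * `|x - y|.

(** Stated on the image side, for pulling arcs back. Since [p, q] has length at most 1, a derivative
    error e changes the length of its image by at most e. *)
Definition contracting (kappa delta : R) := forall x, exists i p q,
  [/\ p <= q, q <= p + 1, lift (F i) p <= x - delta, x + delta <= lift (F i) q &
      forall u, p <= u <= q -> derive1 (lift (F i)) u <= kappa].

Definition expanding (lambda delta : R) := forall x, exists i,
  forall u, x - delta <= u <= x + delta -> lambda <= derive1 (lift (F i)) u.

Let Fex : exists r, forall i, is_circ_diffeo r (F i). Proof. by exists r. Qed.

Lemma wcomp_lipschitz L a x y : 0 <= L -> lipschitz_ifs L ->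
  `|wcomp F a x - wcomp F a y| <= L ^+ size a * `|x - y|.
Proof.
move=> L0 FL; elim: a x y => [|i a IH] x y; first by rewrite mul1r.
rewrite /wcomp /= -!/(wcomp _ _ _); apply: le_trans (IH _ _) _.
by rewrite exprSr -mulrA ler_wpM2l ?exprn_ge0.
Qed.

Fixpoint geometric (L : R) n : R := if n is m.+1 then geometric L m + L ^+ m else 0.

Lemma geometric_le L n m : 0 <= L -> (n <= m)%N -> geometric L n <= geometric L m.
Proof.
move=> L0; elim: m => [|m IH]; first by rewrite leqn0 => /eqP ->.
rewrite leq_eqVlt => /orP[/eqP ->//|/IH H] /=; apply: le_trans H _.
by rewrite lerDl exprn_ge0.
Qed.

Lemma geometric_ge0 L n : 0 <= L -> 0 <= geometric L n.
Proof. by move=> L0; exact: (geometric_le L0 (leq0n n)). Qed.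

(** An error of at most e made at one letter is multiplied by at most L at each later letter. The
    resulting geometric sum depends only on the length of the word, so words of bounded length are
    robust. *)
Lemma wcomp_close L e a x : 0 <= L -> lipschitz_ifs L -> C1_close e ->
  circ_dist_le (wcomp F a x) (wcomp G a x) (e * geometric L (size a)).
Proof.
move=> L0 FL FG; elim: a x => [|i a IH] x.
  by exists 0; rewrite !subrr normr0 mulr0.
rewrite /wcomp /= -!/(wcomp _ _ _).
have [[m Hm] _] := FG i x.
have [m' Hm'] := IH (lift (G i) x).
exists (m + m').
have := wcomp_lipschitz a (lift (F i) x) (lift (G i) x + m%:~R) L0 FL.
rewrite (wcomp_int Fex) => HL.
have {}HL := le_trans HL (ler_wpM2l (exprn_ge0 (size a) L0) (_ : _ <= e)).
have {}HL := HL ltac:(by rewrite opprD addrA).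
move: Hm' HL; rewrite mulrDr [L ^+ _ * e]mulrC intrD.
set g := e * _; set g' := e * _.
rewrite !ler_norml => /andP[h1 h2] /andP[h3 h4]; apply/andP; split; lra.
Qed.

Lemma contracting_pullback kappa kappa' delta e y1 y2 :
  contracting kappa delta -> C1_close e -> e <= delta / 4 -> kappa + e <= kappa' ->
  y1 < y2 -> y2 - y1 <= delta ->
  exists i (m : int) u1 u2, [/\ u1 < u2, y2 - y1 <= kappa' * (u2 - u1),
     lift (G i) u1 = y1 + m%:~R & lift (G i) u2 = y2 + m%:~R].
Proof.
move=> FC FG ed ke y12 yd.
have [i [p [q [pq q1 Fp Fq Fk]]]] := FC ((y1 + y2) / 2).
have Fd := circ_diffeo_is_derive r1 (Fdiff i).
have Gd := circ_diffeo_is_derive r1 (Gdiff i).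
have e0 : 0 <= e by apply: le_trans (normr_ge0 _) (FG i 0).2.
(* Closeness at p fixes the integer m; the mean value theorem for the difference shows that the same
   m serves at q, with error 2e. *)
have [m] := (FG i p).1; rewrite ler_norml => /andP[m1 m2].
have [c _ Ec] := mean_value (fun x => is_deriveB (Fd x) (Gd x)) pq.
have Hc : `|(lift (F i) - lift (G i)) q - (lift (F i) - lift (G i)) p| <= e.
  rewrite Ec normrM; apply: le_trans (_ : e * 1 <= e); last by rewrite mulr1.
  apply: ler_pM => //; first exact: (FG i c).2.
  by rewrite ger0_norm; lra.
move: Hc; rewrite ler_norml !fctE /= => /andP[c1 c2].
have [G1 GK GK' Glt _] := Gdiff i.
have gm x y : lift (G i) x < lift (G i) y -> x < y.
  by rewrite ltNge => /negP H; rewrite ltNge; apply/negP; rewrite le_eqVlt =>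
    /orP[/eqP E|/Glt/ltW//]; apply: H; rewrite E.
pose u1 := ilift (G i) (y1 - m%:~R); pose u2 := ilift (G i) (y2 - m%:~R).
have E1 : lift (G i) u1 = y1 - m%:~R by rewrite GK'.
have E2 : lift (G i) u2 = y2 - m%:~R by rewrite GK'.
have u12 : u1 < u2 by apply: gm; rewrite E1 E2; lra.
have pu : p <= u1.
  by rewrite leNgt; apply/negP => /Glt; rewrite E1; lra.
have uq : u2 <= q.
  by rewrite leNgt; apply/negP => /Glt; rewrite E2; lra.
exists i, (- m), u1, u2; rewrite mulrNz; split=> //.
have [d /andP[d1 d2] Ed] := mean_value Gd (ltW u12).
have -> : y2 - y1 = lift (G i) u2 - lift (G i) u1 by rewrite E1 E2; ring.
rewrite Ed ler_wpM2r//; first by lra.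
have := Fk d; have := (FG i d).2; rewrite ler_norml => /andP[h1 h2] h3.
have := h3 ltac:(apply/andP; split; lra); lra.
Qed.

(** Each pullback lengthens the target arc by a factor of at least 1 / kappa', until its length
    reaches delta. A pulled-back letter acts last, hence [rcons]. *)
Lemma contracting_reach kappa kappa' delta e v1 v2 :
  contracting kappa delta -> C1_close e -> e <= delta / 4 -> kappa + e <= kappa' ->
  0 < kappa' < 1 -> v1 < v2 ->
  exists b y (m : int), forall z, y < z < y + delta -> v1 < wcomp G b z + m%:~R < v2.
Proof.
move=> FC FG ed ke /andP[k0 k1] v12.
have [n Hn] : exists n, delta * kappa' ^+ n <= v2 - v1.
  have : (fun n => delta * kappa' ^+ n) @ \oo --> delta * 0.
    by apply: cvgM; [exact: cvg_cst|apply: cvg_expr; rewrite gtr0_norm].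
  rewrite mulr0 => /cvgrPdist_lt/(_ (v2 - v1)); rewrite subr_gt0 => /(_ v12)[n _ Hn].
  exists n; have := Hn n (leqnn n); rewrite sub0r normrN => /ltW; apply: le_trans.
  exact: ler_norm.
elim: n v1 v2 v12 Hn => [|n IH] v1 v2 v12 Hn.
  exists [::], v1, 0 => z /andP[z1 z2]; rewrite addr0 /wcomp /=.
  by move: Hn; rewrite expr0 => Hn; apply/andP; split; lra.
have [dv|dv] := leP delta (v2 - v1).
  by exists [::], v1, 0 => z /andP[z1 z2]; rewrite addr0 /wcomp /=; apply/andP; split; lra.
have [i [m [u1 [u2 [u12 yu E1 E2]]]]] := contracting_pullback FC FG ed ke v12 (ltW dv).
have [|b [y [m' H]]] := IH u1 u2 u12.
  rewrite -(ler_pM2l k0); apply: le_trans yu; apply: le_trans Hn.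
  by rewrite exprS mulrCA.
have [G1 _ _ Glt _] := Gdiff i.
exists (rcons b i), y, (m' - m) => z /H/andP[/Glt h1 /Glt h2].
rewrite /wcomp foldl_rcons -/(wcomp _ _ _) intrB.
by move: h1 h2; rewrite E1 E2 degree_one_int// => h1 h2; apply/andP; split; lra.
Qed.

(** Forward counterpart of [contracting_reach]: the images of the arc grow by lambda' until their
    length reaches delta. *)
Lemma expanding_spread lambda lambda' delta e u1 u2 :
  expanding lambda delta -> C1_close e -> lambda' <= lambda - e ->
  1 < lambda' -> u1 < u2 ->
  exists a y, forall z, y < z < y + delta -> exists2 z0, u1 < z0 < u2 & wcomp G a z0 = z.
Proof.
move=> FE FG le l1 u12.
have l0 : 0 < lambda' by apply: lt_trans l1.
have [n Hn] : exists n, delta <= (u2 - u1) * lambda' ^+ n.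
  have : (fun n => delta * lambda'^-1 ^+ n) @ \oo --> delta * 0.
    apply: cvgM; [exact: cvg_cst|apply: cvg_expr; rewrite gtr0_norm ?invr_gt0//].
    by rewrite invf_lt1.
  rewrite mulr0 => /cvgrPdist_lt/(_ (u2 - u1)); rewrite subr_gt0 => /(_ u12)[n _ Hn].
  exists n; have := Hn n (leqnn n); rewrite sub0r normrN => /ltW H.
  rewrite -ler_pdivrMr ?exprn_gt0// -exprVn; apply: le_trans H; exact: ler_norm.
elim: n u1 u2 u12 Hn => [|n IH] u1 u2 u12 Hn.
  exists [::], u1 => z /andP[z1 z2]; exists z => //.
  by move: Hn; rewrite expr0 => Hn; apply/andP; split; lra.
have [du|du] := leP delta (u2 - u1).
  by exists [::], u1 => z /andP[z1 z2]; exists z => //; apply/andP; split; lra.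
have [i Hi] := FE u1.
have Gd := circ_diffeo_is_derive r1 (Gdiff i).
have [G1 GK GK' Glt _] := Gdiff i.
have [c /andP[c1 c2] Ec] := mean_value Gd (ltW u12).
have lc : lambda' <= derive1 (lift (G i)) c.
  have := Hi c ltac:(apply/andP; split; lra).
  by have := (FG i c).2; rewrite ler_norml => /andP[h1 h2] h3; lra.
have [||a [y H]] := IH (lift (G i) u1) (lift (G i) u2).
- exact: Glt.
- rewrite Ec; apply: le_trans Hn _; rewrite exprS mulrA ler_wpM2r ?exprn_ge0 ?(ltW l0)//.
  by rewrite mulrC ler_wpM2r//; lra.
exists (i :: a), y => z /H[z0 /andP[z1 z2] <-].
exists (ilift (G i) z0); last by rewrite /wcomp /= GK'.
apply/andP; split.
  by rewrite ltNge; apply/negP; rewrite le_eqVlt => /orP[/eqP E|/Glt];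
    move: z1; rewrite -?E GK' ?ltxx// => h1 h2; lra.
by rewrite ltNge; apply/negP; rewrite le_eqVlt => /orP[/eqP E|/Glt];
    move: z2; rewrite ?E GK' ?ltxx// => h1 h2; lra.
Qed.

End Perturbation.

(** The bound N is uniform in x and y, so [wcomp_close] transfers the connections to nearby
    families; the precision delta/4 leaves room for the error. *)
Definition connecting k (F : 'I_k -> cmap R) delta := exists N, forall x y, exists a z,
  [/\ (size a <= N)%N, x < z < x + delta & circ_dist_le (wcomp F a z) y (delta / 4)].

(** Here every single point is steered, rather than some point of an arc of length delta; this takes
    the place of expansion. *)
Definition spreading k (F : 'I_k -> cmap R) delta := exists N, forall x y, exists2 a,
  (size a <= N)%N & circ_dist_le (wcomp F a x) y (delta / 4).

(** Three words are concatenated: [a] for G, then [a'] chosen for F but read with G, then the word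
    of [contracting_reach]. Aiming at the centre of an arc of length delta absorbs the two errors of
    delta/4. *)
Lemma transitive_perturbation k (F G : 'I_k -> cmap R) r (L kappa kappa' delta : R) N (e : R) :
  reg_ge1 r -> (forall i, is_circ_diffeo r (F i)) -> (forall i, is_circ_diffeo r (G i)) ->
  0 <= L -> lipschitz_ifs F L -> contracting F kappa delta ->
  C1_close F G e -> e <= delta / 4 -> kappa + e <= kappa' -> 0 < kappa' < 1 ->
  0 < delta -> e * geometric L N < delta / 4 ->
  (forall u1 u2 y, u1 < u2 -> exists a a' z0, [/\ u1 < z0 < u2, (size a' <= N)%N &
      circ_dist_le (wcomp F a' (wcomp G a z0)) y (delta / 4)]) ->
  transitive_ifs G.
Proof.
move=> r1 Fd Gd L0 FL FC FG ed ke k01 d0 eN H u1 u2 v1 v2 u12 v12.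
have Gex : exists r, forall i, is_circ_diffeo r (G i) by exists r.
have e0 : 0 <= e.
  have [i _] := FC 0; exact: le_trans (normr_ge0 _) (FG i 0).2.
have [b [y [m Hb]]] := contracting_reach r1 Fd Gd FC FG ed ke k01 v12.
have [a [a' [z0 [uz sa [n Hn]]]]] := H u1 u2 (y + delta / 2) u12.
have [n' Hn'] := wcomp_close Fd a' (wcomp G a z0) L0 FL FG.
have {Hn'} Hn' : `|wcomp F a' (wcomp G a z0) - wcomp G a' (wcomp G a z0) - n'%:~R| < delta / 4.
  apply: le_lt_trans Hn' _; apply: le_lt_trans eN.
  by rewrite ler_wpM2l// geometric_le.
exists (a ++ a' ++ b), z0, (m + n' - n); split=> //.
rewrite !wcomp_cat; set w := wcomp G a' _.
have := Hb (w + (n' - n)%:~R); rewrite (wcomp_int Gex) intrB.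
rewrite addrA intrB intrD.
move: Hn Hn'; rewrite ler_norml ltr_norml => /andP[h1 h2] /andP[h3 h4].
move=> h; have := h ltac:(apply/andP; split; rewrite /w; lra).
by move=> /andP[h5 h6]; apply/andP; split; lra.
Qed.

Lemma SRT_criterion k (F : 'I_k -> cmap R) r (L kappa lambda delta : R) :
  reg_ge1 r -> (forall i, is_circ_diffeo r (F i)) ->
  0 <= L -> lipschitz_ifs F L -> kappa < 1 -> 0 < delta -> 1 < lambda ->
  contracting F kappa delta ->
  spreading F delta \/ expanding F lambda delta /\ connecting F delta ->
  SRT r F.
Proof.
move=> r1 Fd L0 FL k1 d0 l1 FC FS; split=> //.
have [N HN] : exists N, (forall x y, exists2 a,
    (size a <= N)%N & circ_dist_le (wcomp F a x) y (delta / 4)) \/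
  expanding F lambda delta /\ (forall x y, exists a z,
    [/\ (size a <= N)%N, x < z < x + delta & circ_dist_le (wcomp F a z) y (delta / 4)]).
  by case: FS => [[N H]|[E [N H]]]; exists N; [left|right].
have gN := geometric_ge0 N L0.
(* The maximum with 1/2 keeps [kappa'] positive whatever the sign of [kappa]. *)
pose kappa' := Num.max ((1 + kappa) / 2) (1 / 2).
(* The bounds serve, in order, the pullbacks, the contraction rate, the expansion rate, the
   exclusion of the alternative [1 <= 2 ^+ j * d] in the C^oo distance for j at most 1, and the
   comparison of words of length [N]. *)
pose e := Num.min (Num.min (delta / 4) ((1 - kappa) / 2))
   (Num.min (Num.min ((lambda - 1) / 2) (1 / 4)) (delta / 8 / (1 + geometric L N))).
have e0 : 0 < e.
  rewrite !lt_min -!andbA; apply/and5P; split; try lra.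
  by rewrite divr_gt0; lra.
have [e1 e2 e3 [e4 e5]] : [/\ e <= delta / 4, e <= (1 - kappa) / 2, e <= (lambda - 1) / 2
    & e <= 1 / 4 /\ e <= delta / 8 / (1 + geometric L N)].
  by split; [| | |split]; rewrite !ge_min lexx ?orbT.
have e6 : e * geometric L N < delta / 4.
  move: e5; rewrite ler_pdivlMr; last by lra.
  rewrite mulrDr mulr1 => e5; lra.
have k'1 : 0 < kappa' < 1.
  by rewrite gt_max lt_max; apply/andP; split; [apply/orP; right|apply/andP; split]; lra.
have kk : kappa + e <= kappa' by rewrite le_max; apply/orP; left; lra.
(* The C^oo distance gives the first derivative weight 1/2, hence the halving. *)
exists (e / 2); split; first by lra.
move=> G Gd [s [d [sd Hd]]].
have Gsd i : is_circ_diffeo r (G (s i)) by exact: Gd.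
have de i : d i < e / 2.
  apply: le_lt_trans sd; rewrite (bigD1 i)//= lerDl sumr_ge0// => j _.
  by have [] := Hd j.
have FG : C1_close F (fun i => G (s i)) e.
  move=> i x; have [di dr] := Hd i; have dei := de i.
  case: r r1 Fd Gd Gsd Hd dr => [n|] r1 Fd Gd Gsd Hd dr.
    split; first by have [m Hm] := dr 0%N x (leq0n _); exists m; apply: le_trans Hm _; lra.
    by have := dr 1%N x r1; rewrite /pt_le /= => H; apply: le_trans H _; lra.
  split.
    have [|[m]] := dr 0%N x; rewrite expr0 mul1r; first by lra.
    by move=> Hm; exists m; apply: le_trans Hm _; lra.
  have [|] := dr 1%N x; rewrite expr1; first by lra.
  by rewrite /pt_le /= => H; apply: le_trans H _; lra.
have tG : transitive_ifs (fun i => G (s i)).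
  apply: (transitive_perturbation r1 Fd Gsd L0 FL FC FG e1 kk k'1 d0 e6).
  move=> u1 u2 y u12; case: HN => [M|[E T]].
    have [a aN Ha] := M ((u1 + u2) / 2) y.
    by exists [::], a, ((u1 + u2) / 2); split=> //; apply/andP; split; lra.
  have l' : (1 + lambda) / 2 <= lambda - e by lra.
  have l'1 : 1 < (1 + lambda) / 2 by lra.
  have [a [x0 Ha]] := expanding_spread r1 Gsd E FG l' l'1 u12.
  have [a' [z [sa' zx Hz]]] := T x0 y.
  by have [z0 z01 Ez] := Ha z zx; exists a, a', z0; split=> //; rewrite Ez.
have i0 : 'I_k by have /cid[i _] := FC 0.
apply: transitive_dense_orbit => //; first by exists r.
move=> u1 u2 v1 v2 u12 v12.
have [a [x [m [ux vx]]]] := tG _ _ _ _ u12 v12.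
have E b z : wcomp (fun i => G (s i)) b z = wcomp G (map s b) z.
  by elim: b z => //= i b IH z; exact: IH.
by exists (map s a), x, m; rewrite -E.
Qed.

End Robustness.

(** * A family with a common fixed point *)

Section InverseFamilies.
Variable R : realType.

Lemma derive1_cancel (f g df dg : R -> R) :
  (forall x : R, is_derive x 1 f (df x)) -> (forall x : R, is_derive x 1 g (dg x)) ->
  cancel g f -> forall x, df (g x) * dg x = 1.
Proof.
move=> fd gd gK x; have D := @is_derive1_comp _ f g x _ _ (fd (g x)) (gd x).
have E : f \o g = id by apply/funext => y; exact: gK.
by rewrite E in D; rewrite -(@derive_val _ _ _ _ _ _ _ D) derive_id.
Qed.

Lemma lipschitz_derive (f df : R -> R) (L : R) : (forall x : R, is_derive x 1 f (df x)) ->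
  (forall x, `|df x| <= L) -> forall x y, `|f x - f y| <= L * `|x - y|.
Proof.
move=> fd dL x y; wlog xy : x y / y <= x.
  move=> H; have [/H//|/ltW/H H'] := leP y x.
  by rewrite distrC [X in _ <= _ * X]distrC.
have [c _ ->] := mean_value fd xy.
by rewrite normrM ler_wpM2r.
Qed.

(** The inverse of the generator expanding around x contracts the image of the arc
    [x - delta, x + delta] back onto it; [2 * L * delta <= 1] keeps that image within one turn. *)
Lemma expanding_contracting k (F : 'I_k -> cmap R) r (L lambda delta : R) :
  reg_ge1 r -> (forall i, is_circ_diffeo r (F i)) ->
  (forall i, exists j, F j = CMap (ilift (F i)) (lift (F i))) ->
  lipschitz_ifs F L -> 0 < delta -> 2 * L * delta <= 1 -> 0 < lambda ->
  expanding F lambda delta -> contracting F lambda^-1 delta.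
Proof.
move=> r1 Fd Fsym FL d0 dL l0 FE x.
have [i Hi] := FE x; have [j Ej] := Fsym i.
have [_ FK FK' Flt _] := Fd i.
have fd := circ_diffeo_is_derive r1 (Fd i).
have gd := circ_diffeo_is_derive r1 (Fd j).
rewrite Ej /= in gd.
exists j, (lift (F i) (x - delta)), (lift (F i) (x + delta)); rewrite Ej /= !FK.
split=> //.
- by apply/ltW/Flt; lra.
- have := FL i (x + delta) (x - delta).
  have -> : x + delta - (x - delta) = 2 * delta by ring.
  rewrite [`|2 * delta|]ger0_norm; last by lra.
  move=> /(le_trans (ler_norm _)) H; rewrite -lerBlDl; apply: le_trans H _; lra.
move=> u /andP[pu uq].
have [_ _ _ glt _] := Fd j; rewrite Ej /= in glt.
have mono a b : a <= b -> ilift (F i) a <= ilift (F i) b.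
  by rewrite le_eqVlt => /orP[/eqP ->//|/glt/ltW].
have E := derive1_cancel fd gd FK' u.
have := Hi (ilift (F i) u); rewrite -{1}[x - delta]FK -{1}[x + delta]FK !mono// => /(_ isT) Hl.
have D0 : 0 < derive1 (lift (F i)) (ilift (F i) u) by apply: lt_le_trans Hl.
have -> : derive1 (ilift (F i)) u = (derive1 (lift (F i)) (ilift (F i) u))^-1.
  by apply: (mulfI (lt0r_neq0 D0)); rewrite E mulfV// gt_eqF.
by rewrite lef_pV2 ?posrE.
Qed.

Lemma iter_wcomp k (F : 'I_k -> cmap R) n i x : wcomp F (nseq n i) x = iter n (lift (F i)) x.
Proof. by elim: n x => //= n IH x; rewrite [LHS]IH -iterSr. Qed.

Lemma no_int_between (m : int) (a : R) : 0 < a -> a < m%:~R -> m%:~R < 1 - a -> False.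
Proof.
move=> a0 am ma; have : (0 : R) < m%:~R by apply: lt_trans am.
have : m%:~R < 1%:~R :> R by apply: lt_trans ma _; lra.
rewrite ltr_int ltr0z; lia.
Qed.

End InverseFamilies.

Section CommonFixedPoint.
Variable R : realType.

(** Generators move points by at most 2 amp, and 4 amp is exactly delta/4 for the value delta =
    1/100 used below. *)
Definition amp : R := 1 / 1600.
Definition phi_lift (x : R) : R := x + amp * sin (2 * pi * x).
(** With 1 - cos in place of cos, 0 stays fixed and the displacement is nonnegative, vanishing only
    at the integers: iteration pushes points all the way along the circle. *)
Definition psi_lift (x : R) : R := x + amp * (1 - cos (2 * pi * x)).

Lemma Cn_sin_cos n : Cn n (@sin R) /\ Cn n (@cos R).
Proof.
elim: n => [|n [IHs IHc]].
  by split; [apply: (is_derive_continuous (df := cos))|apply: (is_derive_continuous (df := fun x => - sin x))].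
split; first by apply: (CnS_intro (df := cos)).
apply: (CnS_intro (df := fun x => - sin x)).
have -> : (fun x => - sin x) = (fun x : R => - 1 * sin x) by apply/funext => x; rewrite mulN1r.
by apply: CnM => //; exact: Cn_cst.
Qed.

Let lin_is_derive (x : R) : is_derive x 1 (fun y : R => 2 * pi * y) (2 * pi).
Proof.
have := is_deriveZ (2 * pi) (is_derive_id x 1).
by move/is_derive_eq; apply; rewrite /GRing.scale /= mulr1.
Qed.

Lemma is_derive_phi (x : R) : is_derive x 1 phi_lift (1 + amp * (2 * pi) * cos (2 * pi * x)).
Proof.
have D := @is_derive1_comp _ sin _ x _ _ (is_derive_sin _) (lin_is_derive x).
apply: (is_derive_eq (is_deriveD (is_derive_id x 1) (is_deriveZ amp D))).
by rewrite /GRing.scale /=; ring.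
Qed.

Lemma is_derive_psi (x : R) : is_derive x 1 psi_lift (1 + amp * (2 * pi) * sin (2 * pi * x)).
Proof.
have D := @is_derive1_comp _ cos _ x _ _ (is_derive_cos _) (lin_is_derive x).
apply: (is_derive_eq (is_deriveD (is_derive_id x 1)
  (is_deriveZ amp (is_deriveB (is_derive_cst (1 : R) x 1) D)))).
by rewrite /GRing.scale /=; ring.
Qed.

Let Cn_lin n : Cn n (fun x : R => 2 * pi * x).
Proof. by apply: CnM; [exact: Cn_cst|exact: Cn_id]. Qed.

Lemma Cn_phi n : Cn n phi_lift.
Proof.
apply: CnD; first exact: Cn_id.
apply: CnM; first exact: Cn_cst.
by apply: (Cn_comp (f := sin)) => //; have [] := Cn_sin_cos n.
Qed.

Lemma Cn_psi n : Cn n psi_lift.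
Proof.
have C : Cn n (fun x : R => -1 * cos (2 * pi * x) + 1).
  apply: CnD; last exact: Cn_cst.
  apply: CnM; first exact: Cn_cst.
  by apply: (Cn_comp (f := cos)) => //; have [] := Cn_sin_cos n.
have -> : psi_lift = (fun x => x + amp * (-1 * cos (2 * pi * x) + 1)).
  by apply/funext => x; rewrite /psi_lift; ring.
apply: CnD; first exact: Cn_id.
by apply: CnM => //; exact: Cn_cst.
Qed.

Let two_pi_period (x : R) : 2 * pi * (x + 1) = 2 * pi * x + pi *+ 2.
Proof. by rewrite -mulr_natl; ring. Qed.

Lemma phi_degree_one : degree_one phi_lift.
Proof. by move=> x; rewrite /phi_lift two_pi_period sinD2pi; ring. Qed.

Lemma psi_degree_one : degree_one psi_lift.
Proof. by move=> x; rewrite /psi_lift two_pi_period cosD2pi; ring. Qed.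

Lemma pi_lt4 : pi < 4 :> R.
Proof. by have := @pihalf_lt2 R; lra. Qed.

Lemma derive_bounds (t : R) : -1 <= t <= 1 -> 1 / 2 <= 1 + amp * (2 * pi) * t <= 2.
Proof.
move=> /andP[t1 t2]; have := @pi_ge2 R; have := pi_lt4; rewrite /amp.
by move=> p4 p2; apply/andP; split; nra.
Qed.

Lemma phi_derive1 : derive1 phi_lift = fun x => 1 + amp * (2 * pi) * cos (2 * pi * x).
Proof. by apply/funext => x; rewrite derive1E (@derive_val _ _ _ _ _ _ _ (is_derive_phi x)). Qed.

Lemma psi_derive1 : derive1 psi_lift = fun x => 1 + amp * (2 * pi) * sin (2 * pi * x).
Proof. by apply/funext => x; rewrite derive1E (@derive_val _ _ _ _ _ _ _ (is_derive_psi x)). Qed.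

Lemma phi_derive_bounds x : 1 / 2 <= derive1 phi_lift x <= 2.
Proof. by rewrite phi_derive1; apply: derive_bounds; rewrite cos_geN1 cos_le1. Qed.

Lemma psi_derive_bounds x : 1 / 2 <= derive1 psi_lift x <= 2.
Proof. by rewrite psi_derive1; apply: derive_bounds; rewrite sin_geN1 sin_le1. Qed.

Definition fixing_ifs k (i : 'I_k) : cmap R :=
  match val i with
  | 0 => CMap phi_lift (inverse_lift phi_lift)
  | 1 => CMap (inverse_lift phi_lift) phi_lift
  | 2 => CMap psi_lift (inverse_lift psi_lift)
  | 3 => CMap (inverse_lift psi_lift) psi_lift
  | _ => CMap id id
  end.

Let phi_derive_gt0 x : 0 < derive1 phi_lift x.
Proof. by have /andP[h _] := phi_derive_bounds x; lra. Qed.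

Let psi_derive_gt0 x : 0 < derive1 psi_lift x.
Proof. by have /andP[h _] := psi_derive_bounds x; lra. Qed.

Lemma id_diffeo r : is_circ_diffeo r (@CMap R id id).
Proof. by split=> //; split; case: r => [n|] //=; try (move=> n); exact: Cn_id. Qed.

Lemma fixing_diffeo k r (i : 'I_k) : is_circ_diffeo r (fixing_ifs i).
Proof.
have [p1 p2] := inverse_lift_diffeo Cn_phi phi_degree_one phi_derive_gt0 r.
have [q1 q2] := inverse_lift_diffeo Cn_psi psi_degree_one psi_derive_gt0 r.
rewrite /fixing_ifs; case: (val i) => [|[|[|[|n]]]] //; exact: id_diffeo.
Qed.

End CommonFixedPoint.

(** * Expansion, connections and the fixed fibre of the first family *)

Section FixingIfs.
Variable R : realType.
Local Notation amp := (amp R).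
Local Notation phi_lift := (@phi_lift R).
Local Notation psi_lift := (@psi_lift R).

Lemma trig_lipschitz (x y : R) :
  `|cos (2 * pi * x) - cos (2 * pi * y)| <= 8 * `|x - y| /\
  `|sin (2 * pi * x) - sin (2 * pi * y)| <= 8 * `|x - y|.
Proof.
have H : `|2 * pi * x - 2 * pi * y| <= 8 * `|x - y|.
  rewrite -mulrBr normrM ler_wpM2r// ger0_norm; first by have := pi_lt4 R; lra.
  by have := @pi_ge2 R; lra.
split; apply: le_trans H; rewrite -[X in _ <= X]mul1r.
  apply: (lipschitz_derive (df := fun x => - sin x)) => z.
  by rewrite normrN ler_norml sin_geN1 sin_le1.
apply: (lipschitz_derive (df := cos)) => z.
by rewrite ler_norml cos_geN1 cos_le1.
Qed.

Lemma phi_displacement x : `|phi_lift x - x| <= 2 * amp.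
Proof.
have := @sin_geN1 R (2 * pi * x); have := @sin_le1 R (2 * pi * x).
by rewrite /phi_lift /amp ler_norml => h1 h2; apply/andP; split; lra.
Qed.

Lemma psi_displacement x : 0 <= psi_lift x - x <= 2 * amp.
Proof.
have := @cos_geN1 R (2 * pi * x); have := @cos_le1 R (2 * pi * x).
by rewrite /psi_lift /amp => h1 h2; apply/andP; split; lra.
Qed.

Section Family.
Variable k : nat.
Hypothesis k8 : (8 <= k)%N.
Local Notation F := (@fixing_ifs R k).

Let reg1 : reg_ge1 (Fin 1). Proof. by []. Qed.
Let Fd i : is_circ_diffeo (Fin 1) (F i). Proof. exact: fixing_diffeo. Qed.
Let ltk n : (n < 8)%N -> (n < k)%N. Proof. by move=> n8; exact: leq_trans k8. Qed.
Let letter n (n8 : (n < 8)%N) : 'I_k := Ordinal (ltk n8).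

Lemma fixing_inverse i : exists j, F j = CMap (ilift (F i)) (lift (F i)).
Proof.
case: i => -[|[|[|[|n]]]] ik; [exists (@letter 1 isT)|exists (@letter 0 isT)|
  exists (@letter 3 isT)|exists (@letter 2 isT)|exists (@letter 4 isT)] => //.
Qed.

Lemma fixing_derive_inverse i j : F j = CMap (ilift (F i)) (lift (F i)) ->
  forall x, derive1 (lift (F i)) (ilift (F i) x) * derive1 (lift (F j)) x = 1.
Proof.
move=> E; have fd := circ_diffeo_is_derive reg1 (Fd i).
have gd := circ_diffeo_is_derive reg1 (Fd j).
rewrite E /= in gd *; apply: derive1_cancel => //.
by have [] := Fd i.
Qed.

Lemma fixing_derive_bounds i x : 1 / 2 <= derive1 (lift (F i)) x <= 2.
Proof.
have inv i1 j1 : F j1 = CMap (ilift (F i1)) (lift (F i1)) ->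
    (forall x, 1 / 2 <= derive1 (lift (F i1)) x <= 2) ->
    1 / 2 <= derive1 (lift (F j1)) x <= 2.
  move=> E B; have := fixing_derive_inverse E x.
  have /andP := B (ilift (F i1) x).
  move: (derive1 _ _) (derive1 _ _) => a b [a1 a2] ab.
  by apply/andP; split; nra.
case: i => -[|[|[|[|n]]]] ik.
- exact: phi_derive_bounds.
- by apply: (inv (@letter 0 isT)) => // y; exact: phi_derive_bounds.
- exact: psi_derive_bounds.
- by apply: (inv (@letter 2 isT)) => // y; exact: psi_derive_bounds.
- rewrite /= derive1E derive_id; apply/andP; split; lra.
Qed.

Lemma fixing_lipschitz : lipschitz_ifs F 2.
Proof.
move=> i; apply: (lipschitz_derive (circ_diffeo_is_derive reg1 (Fd i))) => x.
by have /andP[h1 h2] := fixing_derive_bounds i x; rewrite ger0_norm; lra.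
Qed.

Let inverse_expansion (a b : R) : a <= 1 - 2 * amp -> 1 / 2 <= a -> a * b = 1 -> 1 + amp <= b.
Proof. by rewrite /amp => h1 h2 h3; nra. Qed.

(** As cos^2 + sin^2 = 1 > 2 (7/10)^2, one of the two is at least 7/10 in absolute value. Its sign
    selects the generator or its inverse, and the Lipschitz constant 8 keeps the value beyond 1/2 on
    the whole arc. *)
Lemma fixing_expanding : expanding F (1 + amp) (1 / 100).
Proof.
move=> x.
have inv (i j : 'I_k) (t : R -> R) :
  F j = CMap (ilift (F i)) (lift (F i)) ->
  (forall y, `|lift (F i) y - y| <= 2 * amp) ->
  (forall y, derive1 (lift (F i)) y = 1 + amp * (2 * pi) * t y) ->
  (forall y, `|t y - t x| <= 8 * `|y - x|) ->
  t x <= - (7 / 10) -> forall u, x - 1 / 100 <= u <= x + 1 / 100 ->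
  1 + amp <= derive1 (lift (F j)) u.
  move=> E disp fE tl tx u /andP[u1 u2].
  have := fixing_derive_inverse E u.
  have := fixing_derive_bounds i (ilift (F i) u).
  set v := ilift (F i) u.
  have Ev : lift (F i) v = u by have [_ _ -> _ _] := Fd i.
  have := disp v; rewrite Ev ler_norml => /andP[v1 v2].
  have := tl v; rewrite fE => tv.
  (* The radius 1/100 plus the displacement 2 amp = 1/800 of the inverse. *)
  have : `|v - x| <= 9 / 800.
    by move: v1 v2; rewrite /amp ler_norml => v1 v2; apply/andP; split; lra.
  move: tv; rewrite ler_norml => /andP[_ tv] vx.
  have {}tv : t v <= - (1 / 2) by lra.
  have pi2 := @pi_ge2 R.
  have H : 1 + amp * (2 * pi) * t v <= 1 - 2 * amp by rewrite /amp; nra.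
  by move=> /andP[a1 _]; apply: inverse_expansion H a1.
have dir (i : 'I_k) (t : R -> R) :
  (forall y, derive1 (lift (F i)) y = 1 + amp * (2 * pi) * t y) ->
  (forall y, `|t y - t x| <= 8 * `|y - x|) ->
  7 / 10 <= t x -> forall u, x - 1 / 100 <= u <= x + 1 / 100 ->
  1 + amp <= derive1 (lift (F i)) u.
  move=> fE tl tx u /andP[u1 u2]; rewrite fE.
  have : `|u - x| <= 1 / 100 by rewrite ler_norml; apply/andP; split; lra.
  have := tl u; rewrite ler_norml => /andP[tu _] ux.
  have {}tu : 1 / 2 <= t u by lra.
  by have pi2 := @pi_ge2 R; rewrite /amp; nra.
pose c := fun y : R => cos (2 * pi * y); pose s := fun y : R => sin (2 * pi * y).
have cl y : `|c y - c x| <= 8 * `|y - x| by have [] := trig_lipschitz y x.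
have sl y : `|s y - s x| <= 8 * `|y - x| by have [] := trig_lipschitz y x.
have fE y : derive1 phi_lift y = 1 + amp * (2 * pi) * c y by rewrite phi_derive1.
have gE y : derive1 psi_lift y = 1 + amp * (2 * pi) * s y by rewrite psi_derive1.
have pd y : `|psi_lift y - y| <= 2 * amp.
  by have /andP[h1 h2] := psi_displacement y; rewrite ger0_norm.
have := @cos2Dsin2 R (2 * pi * x); rewrite -/(c x) -/(s x) => cs.
have [c1|c1] := leP (7 / 10) (c x).
  by exists (@letter 0 isT); exact: (dir (@letter 0 isT) c).
have [c2|c2] := leP (c x) (- (7 / 10)).
  by exists (@letter 1 isT); exact: (inv (@letter 0 isT) (@letter 1 isT) c _ phi_displacement).
have [s1|s1] := leP (7 / 10) (s x).
  by exists (@letter 2 isT); exact: (dir (@letter 2 isT) s).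
have [s2|s2] := leP (s x) (- (7 / 10)).
  by exists (@letter 3 isT); exact: (inv (@letter 2 isT) (@letter 3 isT) s _ pd).
by exfalso; move: cs; nra.
Qed.

(** The displacement 2 amp sin^2(pi z) has a positive minimum s on [d, 1 - d], so a number of
    iterations of order 1/s suffices; the last one overshoots y by at most 2 amp. *)
Lemma psi_push (d : R) : 0 < d < 1 / 2 -> exists N, forall z y, d <= z -> z <= y -> y <= 1 - d ->
  exists2 n, (n <= N)%N & y <= iter n psi_lift z <= y + 2 * amp.
Proof.
move=> /andP[d0 d1].
have [s s0 sP] : exists2 s, 0 < s & forall z, d <= z <= 1 - d -> s <= psi_lift z - z.
  have dd : d <= 1 - d by lra.
  have C : {within `[d, 1 - d], continuous (fun z => psi_lift z - z)}.
    apply: continuous_subspaceT => z; apply: cvgB; last exact: cvg_id.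
    exact: (Cn_continuous (Cn_psi R 0)).
  have [z0 z0d H] := EVT_min dd C.
  exists (psi_lift z0 - z0); last by move=> z zd; apply: H; rewrite in_itv.
  move: z0d; rewrite in_itv /= => /andP[z1 z2].
  have p0 := @pi_gt0 R.
  have S : 0 < sin (pi * z0).
    by apply: sin_gt0_pi; apply/andP; split; nra.
  have -> : psi_lift z0 - z0 = 2 * amp * sin (pi * z0) ^+ 2.
    rewrite /psi_lift.
    have -> : 2 * pi * z0 = (pi * z0) *+ 2 by rewrite -mulr_natl; ring.
    by rewrite cos_mulr2n cos2sin2 -mulr_natl; ring.
  by apply: mulr_gt0; [rewrite /amp; lra|exact: exprn_gt0].
pose N := (Num.truncn (1 / s)).+1.
have HN : 1 <= N%:R * s.
  by rewrite -ler_pdivrMr// ltW// truncnS_gt.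
exists N => z y dz zy y1.
have {HN} : y - z <= N%:R * s by lra.
move: N => N; elim: N z dz zy => [|N IH] z dz zy H.
  by exists 0%N => //=; rewrite /amp; apply/andP; split; lra.
have /andP[p1 p2] := psi_displacement z.
have := sP z ltac:(apply/andP; split; lra) => ps.
have [yp|py] := leP y (psi_lift z).
  by exists 1%N => //=; apply/andP; split; lra.
have [|||n nN] := IH (psi_lift z); try lra.
by rewrite -iterSr; exists n.+1.
Qed.

Lemma away_from_int (d x : R) : 0 < d < 1 / 4 -> exists z (m : int),
  x <= z <= x + 2 * d /\ d <= z - m%:~R <= 1 - d.
Proof.
move=> /andP[d0 d1]; have /andP[m1 m2] := floor_itv x.
set m := Num.floor x in m1 m2; rewrite intrD in m2.
have [h|h] := ltP (x - m%:~R) d.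
  by exists (m%:~R + d), m; split; apply/andP; split; lra.
have [h'|h'] := ltP (1 - d) (x - m%:~R).
  by exists (m%:~R + 1 + d), (m + 1); rewrite intrD; split; apply/andP; split; lra.
by exists x, m; split; apply/andP; split; lra.
Qed.

Let Fex : exists r, forall i, is_circ_diffeo r (F i). Proof. by exists (Fin 1). Qed.

Lemma fixing_connecting : connecting F (1 / 100).
Proof.
have amp4 : 0 < amp < 1 / 4 by rewrite /amp; apply/andP; split; lra.
have [N HN] := @psi_push amp ltac:(rewrite /amp; apply/andP; split; lra).
exists N => x y.
(* Near the fixed point the push is too slow, so source and target are first moved off it, by at
   most 2 amp each; the shift 1/800 keeps z strictly beyond x. *)
have [z [m [/andP[xz zx] /andP[z1 z2]]]] := away_from_int (x + 1 / 800) amp4.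
have [y' [m' [/andP[yy' y'y] /andP[y1 y2]]]] := away_from_int y amp4.
have ampE : amp = 1 / 1600 by [].
have cast n i (w : R) (l : int) :
    wcomp F (nseq n i) (w + l%:~R) = iter n (lift (F i)) w + l%:~R.
  by rewrite wcomp_int// iter_wcomp.
have [zy|yz] := leP (z - m%:~R) (y' - m'%:~R).
  have [n nN /andP[n1 n2]] := HN _ _ z1 zy y2.
  exists (nseq n (@letter 2 isT)), z; rewrite size_nseq; split=> //.
    by apply/andP; split; lra.
  exists (m - m'); rewrite -[z](subrK m%:~R) cast/= intrB.
  by rewrite ler_norml; apply/andP; split; lra.
(* To go backwards, the target is pushed forward until just past z; from there the inverse iterates
   lead exactly to the target. *)
have [n nN /andP[n1 n2]] := HN _ _ y1 (ltW yz) z2.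
exists (nseq n (@letter 3 isT)), (iter n psi_lift (y' - m'%:~R) + m%:~R).
rewrite size_nseq; split=> //; first by apply/andP; split; lra.
exists (m - m'); rewrite cast /=.
have -> : iter n (inverse_lift psi_lift) (iter n psi_lift (y' - m'%:~R)) = y' - m'%:~R.
  have [_ psiK _ _ _] := Fd (@letter 2 isT).
  elim: n {nN n1 n2} => // n IH; rewrite iterSr [iter n.+1 psi_lift _]iterS.
  by rewrite -[RHS]IH; congr (iter n _ _); exact: psiK.
by rewrite intrB ler_norml; apply/andP; split; lra.
Qed.

Lemma fixing_SRT r : reg_ge1 r -> SRT r F.
Proof.
move=> r1; have Fr i : is_circ_diffeo r (F i) by exact: fixing_diffeo.
have a0 : 0 < amp by rewrite /amp; lra.
apply: (@SRT_criterion _ _ F r 2 (1 + amp)^-1 (1 + amp) (1 / 100)) => //; try lra.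
- exact: fixing_lipschitz.
- by rewrite invf_lt1; lra.
- apply: (expanding_contracting r1 Fr fixing_inverse fixing_lipschitz) => //; try lra.
  exact: fixing_expanding.
- by right; split; [exact: fixing_expanding|exact: fixing_connecting].
Qed.

Lemma fixing_zero i : lift (F i) 0 = 0 /\ ilift (F i) 0 = 0.
Proof.
have z1 : phi_lift 0 = 0 by rewrite /phi_lift mulr0 sin0; ring.
have z2 : psi_lift 0 = 0 by rewrite /psi_lift mulr0 cos0; ring.
have cz j : lift (F j) 0 = 0 -> ilift (F j) 0 = 0.
  by move=> E; rewrite -[X in ilift _ X]E; have [_ -> _ _ _] := Fd j.
have := cz (@letter 0 isT) z1; have := cz (@letter 2 isT) z2.
by case: i => -[|[|[|[|n]]]] ik.
Qed.

Lemma wcomp_fixing_zero a : wcomp F a 0 = 0.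
Proof. by elim: a => //= i a IH; rewrite /wcomp/= (fixing_zero i).1. Qed.

Lemma not_dense_int (S : set (Sigma k * R)) :
  (forall q, S q -> exists m : int, q.2 = m%:~R) -> ~ dense_set S.
Proof.
move=> H /(_ (fun=> @letter 0 isT, 1 / 2) 0%N (1 / 4)) D.
have [|s [/H[m Em] [_ [m' /=]]]] := D; first by lra.
rewrite Em ltr_norml => /andP[h1 h2].
by apply: (@no_int_between R (m - m') (1 / 4)); rewrite ?intrB; lra.
Qed.

Lemma fixing_not_minimal_ss : ~ minimal_ss F.
Proof.
move=> /(_ (fun=> @letter 0 isT, 0)); apply: not_dense_int => q [n].
rewrite !iter_Phi /= wcomp_fixing_zero => -[_ [m]]; rewrite subr0.
set a := mkseq _ _ => E; exists m.
(* The word fixes the integer m and is strictly increasing, so the point sent to m is m itself. *)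
have E' : wcomp F a m%:~R = m%:~R.
  by rewrite -[X in wcomp _ _ X]add0r wcomp_int// wcomp_fixing_zero add0r.
have [/(wcomp_lt Fex a)|/(wcomp_lt Fex a)|//] := ltgtP q.2 m%:~R; by rewrite E' E ltxx.
Qed.

Lemma fixing_not_minimal_uu : ~ minimal_uu F.
Proof.
move=> /(_ (fun=> @letter 0 isT, 0)); apply: not_dense_int => q [n [z [_ [z0 [_ q0]]]]].
have E : (iter n (Phiinv F) (fun=> @letter 0 isT, 0)).2 = 0.
  by elim: n {z0 q0} => //= n ->; rewrite (fixing_zero _).2.
move: z0 q0; rewrite E => -[m]; rewrite subr0 => zm [m'].
rewrite iter_Phi /= zm -[X in wcomp _ _ X]add0r wcomp_int// wcomp_fixing_zero => H.
by exists (m + m'); rewrite intrD; lra.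
Qed.

End Family.
End FixingIfs.

(** * Tripling arcs and an invariant Cantor set *)

Section TriplingArc.
Variable R : realType.

Lemma is_derive_smooth_step (x : R) :
  is_derive x 1 (@smooth_step R) (derive1 (@smooth_step R) x).
Proof. by have [] := CnS_elim (Cn_smooth_step R 1). Qed.

Lemma smooth_step_flat (x : R) : x < 0 \/ 1 < x -> derive1 (@smooth_step R) x = 0.
Proof.
move=> H; suff D : is_derive x 1 (@smooth_step R) 0 by rewrite derive1E (@derive_val _ _ _ _ _ _ _ D).
case: H => x0.
- apply: (near_eq_is_derive (f := fun=> 0 : R)).
  near=> y; rewrite smooth_step0// ltW//; near: y; exact: lt_nbhsl.
- apply: (near_eq_is_derive (f := fun=> 1 : R)).
  near=> y; rewrite smooth_step1// ltW//; near: y; exact: lt_nbhsr.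
Unshelve. all: by end_near.
Qed.

(** [s1] rises over [113/200, 115/200] and [s2] over [85/100, 88/100]. The coefficients of [line]
    make x / 27 + 26/27 [line x] equal to 3 x - 5/3. *)
Let s1 (x : R) := smooth_step (100 * x + - (113 / 2)).
Let s2 (x : R) := smooth_step (100 / 3 * x + - (85 / 3)).
Let line (x : R) := 80 / 26 * x + - (45 / 26).

(* Both transitions jump upwards, which keeps base increasing: line is nonnegative
   from 9/16 on, before s1 starts, and at most 1 until 71/80, after s2 has ended. *)
Definition jump (x : R) : R := s1 x * line x * (1 + -1 * s2 x) + s2 x.

(** Slope 1/27 at both ends, with values 0 at 0 and 1 at 1, lets the integer translates glue
    smoothly. Slopes that are powers of 3, and the offset 5/3, a multiple of 1/3, are compatible
    with K. *)
Definition base (x : R) : R := (1 / 27 * x + 0) + 26 / 27 * jump x.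

Lemma base_slow x : x <= 113 / 200 -> base x = x / 27.
Proof.
move=> H; rewrite /base /jump /s1 /s2 !smooth_step0; try lra.
Qed.

Lemma base_fast x : 115 / 200 <= x <= 85 / 100 -> base x = 3 * x - 5 / 3.
Proof.
move=> /andP[h1 h2]; rewrite /base /jump /s1 /s2 /line smooth_step1; last by lra.
rewrite smooth_step0; last by lra.
by field.
Qed.

Lemma base_end x : 88 / 100 <= x -> base x = x / 27 + 26 / 27.
Proof.
move=> h; rewrite /base /jump /s1 /s2 /line smooth_step1; last by lra.
rewrite smooth_step1; last by lra.
by field.
Qed.

Lemma Cn_base n : Cn n base.
Proof.
have C1 : Cn n s1 by apply: (Cn_comp (f := @smooth_step R)); [exact: Cn_smooth_step|exact: Cn_affine].
have C2 : Cn n s2 by apply: (Cn_comp (f := @smooth_step R)); [exact: Cn_smooth_step|exact: Cn_affine].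
apply: CnD; first exact: Cn_affine.
apply: CnM; first exact: Cn_cst.
apply: CnD => //; apply: CnM; first by apply: CnM => //; exact: Cn_affine.
by apply: CnD; [exact: Cn_cst|apply: CnM => //; exact: Cn_cst].
Qed.

Let aff_is_derive (p q x : R) : is_derive x 1 (fun y => p * y + q) p.
Proof.
have D := is_deriveD (is_deriveZ p (is_derive_id x 1)) (is_derive_cst q x 1).
by apply: (is_derive_eq D); rewrite /GRing.scale /= mulr1 addr0.
Qed.

Lemma base_derive_ge x : 1 / 27 <= derive1 base x.
Proof.
pose d1 := derive1 (@smooth_step R) (100 * x + - (113 / 2)) * 100.
pose d2 := derive1 (@smooth_step R) (100 / 3 * x + - (85 / 3)) * (100 / 3).
have D1 : is_derive x 1 s1 d1.
  exact: (@is_derive1_comp _ (@smooth_step R) _ x _ _ (is_derive_smooth_step _) (aff_is_derive _ _ _)).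
have D2 : is_derive x 1 s2 d2.
  exact: (@is_derive1_comp _ (@smooth_step R) _ x _ _ (is_derive_smooth_step _) (aff_is_derive _ _ _)).
have DL : is_derive x 1 line (80 / 26) by exact: aff_is_derive.
have DN := is_deriveD (is_derive_cst (1 : R) x 1) (is_deriveZ (-1) D2).
have DJ := is_deriveD (is_deriveM (is_deriveM D1 DL) DN) D2.
have DB := is_deriveD (aff_is_derive (1 / 27) 0 x) (is_deriveZ (26 / 27) DJ).
(* The derivative of [jump], grouped into two terms that are each nonnegative. *)
pose j := (1 - s2 x) * (d1 * line x + s1 x * (80 / 26)) + d2 * (1 - s1 x * line x).
have D : is_derive x 1 base (1 / 27 + 26 / 27 * j).
  by apply: (is_derive_eq DB); rewrite /j /GRing.scale /= !fctE /GRing.scale /= !scaleN1r; ring.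
rewrite derive1E (@derive_val _ _ _ _ _ _ _ D).
have /andP[s10 s11] := smooth_step_bounds (100 * x + - (113 / 2)).
have /andP[s20 s21] := smooth_step_bounds (100 / 3 * x + - (85 / 3)).
rewrite -/(s1 x) in s10 s11; rewrite -/(s2 x) in s20 s21.
have d10 : 0 <= d1 by rewrite mulr_ge0// smooth_step_derive_ge0.
have d20 : 0 <= d2 by apply: mulr_ge0; [exact: smooth_step_derive_ge0|lra].
have J1 : 0 <= d1 * line x.
  have [h|h] := leP (9 / 16) x; first by apply: mulr_ge0 => //; rewrite /line; lra.
  by rewrite /d1 smooth_step_flat ?mul0r//; left; lra.
have J2 : 0 <= d2 * (1 - s1 x * line x).
  have [h|h] := leP x (71 / 80).
    apply: mulr_ge0 => //; rewrite subr_ge0.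
    have l1 : line x <= 1 by rewrite /line; lra.
    have [l0|l0] := leP 0 (line x); first by rewrite mulr_ile1.
    by apply: le_trans ler01; rewrite mulr_ge0_le0// ltW.
  by rewrite /d2 smooth_step_flat ?mul0r//; right; lra.
have J3 : 0 <= (1 - s2 x) * (d1 * line x + s1 x * (80 / 26)).
  apply: mulr_ge0; first by rewrite subr_ge0.
  by apply: addr_ge0 => //; apply: mulr_ge0 => //; lra.
rewrite /j; move: J2 J3; set A := d2 * _; set B := (1 - s2 x) * _ => J2 J3; lra.
Qed.

Definition tripling (x : R) : R :=
  base (x - (Num.floor x)%:~R) + (Num.floor x)%:~R.

Lemma tripling_degree_one : degree_one tripling.
Proof.
move=> x; have E : Num.floor (x + 1) = Num.floor x + 1.
  have /andP[h1 h2] := floor_itv x; rewrite intrD in h2.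
  by apply: floor_def; rewrite !intrD; apply/andP; split; lra.
rewrite /tripling E intrD; set m := (Num.floor x)%:~R.
have -> : x + 1 - (m + 1%:~R) = x - m by ring.
by ring.
Qed.

(** Just below an integer the end piece of one period and the slow piece of the next are the same
    affine map; this overlap gives smoothness at the integers. *)
Lemma tripling_local (m : int) x : m%:~R - 1 / 10 < x < m%:~R + 1 ->
  tripling x = base (x - m%:~R) + m%:~R.
Proof.
move=> /andP[h1 h2]; have [xm|xm] := leP m%:~R x.
  suff E : Num.floor x = m by rewrite /tripling E.
  by apply: floor_def; rewrite xm/= intrD.
have E : Num.floor x = m - 1.
  by apply: floor_def; rewrite subrK xm andbT intrB; lra.
rewrite /tripling E intrB [in LHS]base_end; last by lra.
by rewrite base_slow; [field|lra].
Qed.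

Let near_local (x : R) : \forall y \near x,
  tripling y = base (1 * y + - (Num.floor x)%:~R) + (Num.floor x)%:~R.
Proof.
have /andP[h1 h2] := floor_itv x; rewrite intrD in h2.
near=> y; rewrite mul1r; apply: tripling_local.
apply/andP; split; near: y; [apply: lt_nbhsr; lra|exact: lt_nbhsl].
Unshelve. all: by end_near.
Qed.

Lemma Cn_tripling n : Cn n tripling.
Proof.
apply: Cn_near => x.
exists (fun y => base (1 * y + - (Num.floor x)%:~R) + (Num.floor x)%:~R) => //.
apply: CnD; last exact: Cn_cst.
by apply: (Cn_comp (f := base)); [exact: Cn_base|exact: Cn_affine].
Qed.

Lemma tripling_derive_ge x : 1 / 27 <= derive1 tripling x.
Proof.
have [Bd _] := CnS_elim (Cn_base 1).
set m := (Num.floor x)%:~R : R.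
have D1 := @is_derive1_comp _ base _ x _ _ (Bd (1 * x + - m)) (aff_is_derive 1 (- m) x).
have D2 := is_deriveD D1 (is_derive_cst m x 1).
have D : is_derive x 1 tripling (derive1 base (1 * x + - m)).
  have D3 : is_derive x 1 (fun y : R => base (1 * y + - m) + m) (derive1 base (1 * x + - m)).
    by apply: (is_derive_eq D2); rewrite mulr1 addr0.
  apply: near_eq_is_derive D3.
  by apply: filterS (near_local x) => y ->.
by rewrite derive1E (@derive_val _ _ _ _ _ _ _ D) base_derive_ge.
Qed.

(* K is the lift of a Cantor set: its image under multiplication by 3 consists
   of the points of R/Z whose orbit under x |-> 3x stays in [0, 1/2]. *)
Definition Kset (x : R) : Prop :=
  forall n, exists m : int, 0 <= 3 ^+ n.+1 * x - m%:~R <= 1 / 2.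

Lemma Kset0 : Kset 0.
Proof. by move=> n; exists 0; rewrite mulr0 subr0 lexx; lra. Qed.

Lemma Kset_triple x : Kset x -> Kset (3 * x).
Proof. by move=> K n; have [m H] := K n.+1; exists m; rewrite mulrA -exprSr. Qed.

Lemma Kset_shift (l : int) x : Kset x -> Kset (x + l%:~R / 3).
Proof.
move=> K n; have [m H] := K n; exists (m + 3 ^+ n * l).
rewrite intrD intrM rmorphXn /=.
suff -> : 3 ^+ n.+1 * (x + l%:~R / 3) - (m%:~R + 3%:~R ^+ n * l%:~R) = 3 ^+ n.+1 * x - m%:~R by [].
by rewrite exprS; field.
Qed.

Lemma Kset_third x : Kset x -> 0 <= x <= 1 / 2 -> Kset (x / 3).
Proof.
move=> K /andP[x0 x1] [|n].
  by exists 0; rewrite expr1 mulrCA divff ?mulr1 ?subr0 ?x0//; lra.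
have [m H] := K n; exists m.
suff -> : 3 ^+ n.+2 * (x / 3) = 3 ^+ n.+1 * x by [].
by rewrite [3 ^+ n.+2]exprSr; field.
Qed.

Lemma Kset_reflect x : Kset x -> Kset (1 / 2 - x).
Proof.
move=> K n; have [m /andP[h1 h2]] := K n.
(* Powers of 3 are odd, so 3^(n+1) / 2 is 1/2 modulo 1, and [0, 1/2] is reflected onto itself. *)
have [c Ec] : exists c : int, 3 ^+ n.+1 = 2 * c%:~R + 1 :> R.
  elim: (n.+1) => [|j [c Ec]]; first by exists 0; rewrite expr0; ring.
  by exists (3 * c + 1); rewrite exprS Ec intrD intrM; ring.
exists (c - m); rewrite mulrBr {1}Ec intrB.
by apply/andP; split; lra.
Qed.

(** Modulo 1, a point of K lies either in [0, 1/2], where dividing by 27 is three uses of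
    [Kset_third], or in [2/3, 5/6], inside the arc where the map is 3 x - 5/3. *)
Lemma Kset_tripling x : Kset x -> Kset (tripling x).
Proof.
move=> K; rewrite /tripling; set m := Num.floor x.
have -> : (m%:~R : R) = (3 * m)%:~R / 3 by rewrite intrM; field.
apply: Kset_shift.
have /andP[h1 h2] := floor_itv x; rewrite -/m intrD in h1 h2.
have K0 : Kset (x - m%:~R).
  have -> : x - m%:~R = x + (- (3 * m))%:~R / 3 by rewrite mulrNz intrM; field.
  exact: Kset_shift.
have -> : (3 * m)%:~R / 3 = m%:~R :> R by rewrite intrM; field.
have {h1 h2} : 0 <= x - m%:~R < 1 by apply/andP; split; lra.
move: (x - m%:~R) K0 => y K0 /andP[y0 y1].
have [l] := K0 0%N; rewrite expr1 => /andP[l0 l1].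
have [y2|y2] := leP y (1 / 2).
  rewrite base_slow; last by lra.
  have -> : y / 27 = y / 3 / 3 / 3 by field.
  by do 3![apply: Kset_third; last by apply/andP; split; lra].
have l2 : (1 : R) < l%:~R by lra.
have l3 : l%:~R < (3 : R) by lra.
have {l2 l3} El : l = 2.
  by move: l2 l3; rewrite (ltr_int R 1 l) (ltr_int R l 3); lia.
rewrite El in l0 l1.
rewrite base_fast; last by apply/andP; split; lra.
have -> : 3 * y - 5 / 3 = 3 * y + (-5)%:~R / 3 by rewrite mulrNz; field.
by apply: Kset_shift; exact: Kset_triple.
Qed.

End TriplingArc.

(** * The family of inverse branches of tripling *)

Section CantorIfs.
Variable R : realType.
Implicit Types (x y u t : R).

(** Conjugate of [tripling] by x -> 1/2 - x, a symmetry of K. Its arc of slope 3 covers the points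
    that the first arc and its translates by thirds miss. *)
Definition reflected x : R := 1 / 2 + -1 * @tripling R (-1 * x + 1 / 2).

Let half_reflect x : -1 * x + 1 / 2 = 1 / 2 - x. Proof. by ring. Qed.

Lemma Kset_reflected x : Kset x -> Kset (reflected x).
Proof.
move=> K; rewrite /reflected mulN1r half_reflect.
by do 2![apply: Kset_reflect => //; try apply: Kset_tripling].
Qed.

Definition uniform_lift (f : R -> R) :=
  [/\ forall n, Cn n f, degree_one f & forall x, 1 / 27 <= derive1 f x].

Let affine_derive (p q x : R) : is_derive x 1 (fun y => p * y + q) p.
Proof.
have D := is_deriveD (is_deriveZ p (is_derive_id x 1)) (is_derive_cst q x 1).
by apply: (is_derive_eq D); rewrite /GRing.scale /= mulr1 addr0.
Qed.

Lemma uniform_tripling : uniform_lift (@tripling R).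
Proof.
by split; [exact: Cn_tripling|exact: tripling_degree_one|exact: tripling_derive_ge].
Qed.

Lemma uniform_reflected : uniform_lift reflected.
Proof.
split.
- move=> n; apply: CnD; first exact: Cn_cst.
  apply: CnM; first exact: Cn_cst.
  by apply: (Cn_comp (f := @tripling R)); [exact: Cn_tripling|exact: Cn_affine].
- move=> x; rewrite /reflected.
  have -> : -1 * (x + 1) + 1 / 2 = -1 * x + 1 / 2 + (-1)%:~R by rewrite mulrNz; ring.
  rewrite (degree_one_int _ _ (@tripling_degree_one R)) mulrNz.
  by set t := tripling _; lra.
- move=> x; have [Td _] := CnS_elim (Cn_tripling R 1).
  have D1 := @is_derive1_comp _ (@tripling R) _ x _ _ (Td _) (affine_derive (-1) (1 / 2) x).
  have D2 := is_deriveD (is_derive_cst (1 / 2 : R) x 1) (is_deriveZ (-1) D1).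
  have D : is_derive x 1 reflected (derive1 (@tripling R) (-1 * x + 1 / 2)).
    by apply: (is_derive_eq D2); rewrite scaleN1r mulrN1 add0r opprK.
  by rewrite derive1E (@derive_val _ _ _ _ _ _ _ D); exact: tripling_derive_ge.
Qed.

Lemma uniform_shift f (c : R) : uniform_lift f -> uniform_lift (fun x => f (1 * x + c)).
Proof.
move=> [Cf f1 f2]; split.
- by move=> n; apply: (Cn_comp (f := f)) => //; exact: Cn_affine.
- move=> x; have -> : 1 * (x + 1) + c = 1 * x + c + 1 by ring.
  exact: f1.
- move=> x; have [fd _] := CnS_elim (Cf 1%N).
  have D := @is_derive1_comp _ f _ x _ _ (fd _) (affine_derive 1 c x).
  have -> : derive1 (fun x => f (1 * x + c)) x = derive1 f (1 * x + c) * 1.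
    by rewrite [LHS]derive1E; exact: (@derive_val _ _ _ _ _ _ _ D).
  by rewrite mulr1.
Qed.

Lemma uniform_id : uniform_lift id.
Proof.
split=> [n|x//|x]; first exact: Cn_id.
by rewrite derive1E derive_id; lra.
Qed.

Definition cantor_lift (n : nat) (x : R) : R :=
  match n with
  | 0 | 1 | 2 => @tripling R (1 * x + n%:R / 3)
  | 3 | 4 | 5 => reflected (1 * x + (n - 3)%:R / 3)
  | 6 => 1 * x + 1 / 3
  | _ => 1 * x + 0
  end.

Lemma uniform_cantor_lift n : uniform_lift (cantor_lift n).
Proof.
have T c := uniform_shift c uniform_tripling.
have F c := uniform_shift c uniform_reflected.
have I c := uniform_shift c uniform_id.
by case: n => [|[|[|[|[|[|[|n]]]]]]]; [exact: T|exact: T|exact: T|exact: F|exact: F|exact: F|exact: I|exact: I].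
Qed.

Lemma Kset_cantor_lift n x : Kset x -> Kset (cantor_lift n x).
Proof.
move=> K; have S j : Kset (1 * x + j%:R / 3).
  by rewrite mul1r -[j%:R]/(j%:Z%:~R); exact: Kset_shift.
case: n => [|[|[|[|[|[|[|n]]]]]]] /=; try (by apply: Kset_tripling; exact: S);
  try (by apply: Kset_reflected; exact: S).
  exact: (S 1%N).
by have := S 0%N; rewrite mul0r.
Qed.

Let third_residue (l : int) : exists j : nat, [/\ (j < 3)%N & exists q : int, l + j%:Z = 3 * q].
Proof.
exists (absz ((- l) %% 3)%Z); split; first by lia.
by exists (- ((- l) %/ 3)%Z); lia.
Qed.

(* Modulo 1/3, the arc where tripling has slope 3 and its mirror image cover the
   line, with overlap. *)
Lemma cantor_lift_triples x : exists i (m : int), (i < 6)%N /\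
  forall u, `|u - x| <= 1 / 128 -> cantor_lift i u = 3 * u + m%:~R / 3.
Proof.
(* The offset 3/4 puts s = x - l/3 in [1/4, 7/12). Then s + 1/3 when s <= 1/2, and the reflected
   point 7/6 - s otherwise, lie in [7/12, 5/6]; with the margin 1/128 this stays in
   [115/200, 85/100], where [base] has slope 3. *)
have /andP[l1 l2] := floor_itv (3 * x - 3 / 4).
set l := Num.floor _ in l1 l2; rewrite intrD in l2.
have [h|h] := leP (x - l%:~R / 3) (1 / 2).
- have [j [j3 [q Eq]]] := third_residue (l - 1).
  have EqR : l%:~R - 1 + j%:R = 3 * q%:~R :> R.
    by rewrite -[j%:R]/(j%:Z%:~R) -[1 in LHS]/(1%:~R) -intrB -intrD Eq intrM.
  have T u : `|u - x| <= 1 / 128 ->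
      tripling (1 * u + j%:R / 3) = 3 * u + (3 * q - 3 * (l - 1) - 5)%:~R / 3.
    rewrite ler_norml => /andP[u1 u2].
    have -> : 1 * u + j%:R / 3 = u - (l%:~R - 1) / 3 + q%:~R by lra.
    rewrite (degree_one_int _ _ (@tripling_degree_one R)).
    rewrite (@tripling_local R 0); last by apply/andP; split; lra.
    rewrite subr0 addr0 base_fast; last by apply/andP; split; lra.
    by rewrite !intrB !intrM; field.
  by exists j, (3 * q - 3 * (l - 1) - 5); split; [exact: ltn_trans j3 _|];
    move=> u /T <-; case: j j3 {EqR Eq T} => [|[|[|]]].
- have [j [j3 [q Eq]]] := third_residue (l + 2).
  have EqR : l%:~R + 2 + j%:R = 3 * q%:~R :> R.
    by rewrite -[j%:R]/(j%:Z%:~R) -[2 in LHS]/(2%:~R) -!intrD Eq intrM.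
  have T u : `|u - x| <= 1 / 128 ->
      reflected (1 * u + j%:R / 3) = 3 * u + (3 * q - 3 * (l + 2) + 2)%:~R / 3.
    rewrite ler_norml => /andP[u1 u2]; rewrite /reflected.
    have -> : -1 * (1 * u + j%:R / 3) + 1 / 2 = 1 / 2 - (u - (l%:~R + 2) / 3) + (- q)%:~R.
      by rewrite mulrNz; lra.
    rewrite (degree_one_int _ _ (@tripling_degree_one R)).
    rewrite (@tripling_local R 0); last by apply/andP; split; lra.
    rewrite subr0 addr0 base_fast; last by apply/andP; split; lra.
    by rewrite !(intrD, intrM, mulrNz); field.
  by exists (3 + j)%N, (3 * q - 3 * (l + 2) + 2); split; [by rewrite -[6%N]/(3 + 3)%N ltn_add2l|];
    move=> u /T <-; case: j j3 {EqR Eq T} => [|[|[|]]].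
Qed.

Definition cantor_ifs k (i : 'I_k) : cmap R :=
  CMap (inverse_lift (cantor_lift i)) (cantor_lift i).

Lemma cantor_diffeo k r (i : 'I_k) : is_circ_diffeo r (cantor_ifs i).
Proof.
have [C D H] := uniform_cantor_lift i.
have H0 x : 0 < derive1 (cantor_lift i) x by apply: lt_le_trans (H x); lra.
by have [_] := inverse_lift_diffeo C D H0 r.
Qed.

Section Family.
Variable k : nat.
Hypothesis k8 : (8 <= k)%N.
Local Notation F := (@cantor_ifs k).

Let reg1 : reg_ge1 (Fin 1). Proof. by []. Qed.
Let Fd i : is_circ_diffeo (Fin 1) (F i). Proof. exact: cantor_diffeo. Qed.
Let Fex : exists r, forall i, is_circ_diffeo r (F i). Proof. by exists (Fin 1). Qed.
Let ltk n : (n < 8)%N -> (n < k)%N. Proof. by move=> n8; exact: leq_trans k8. Qed.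
Let letter n (n8 : (n < 8)%N) : 'I_k := Ordinal (ltk n8).
Let hd n x : is_derive x 1 (cantor_lift n) (derive1 (cantor_lift n) x).
Proof.
by have [C _ _] := uniform_cantor_lift n; have [D _] := CnS_elim (C 1%N); exact: D.
Qed.

Lemma cantor_derive_inverse (i : 'I_k) x :
  derive1 (cantor_lift i) (lift (F i) x) * derive1 (lift (F i)) x = 1.
Proof.
apply: (derive1_cancel (hd i) (circ_diffeo_is_derive reg1 (Fd i))).
by have [_] := Fd i.
Qed.

Lemma cantor_lipschitz : lipschitz_ifs F 27.
Proof.
move=> i; apply: (lipschitz_derive (circ_diffeo_is_derive reg1 (Fd i))) => x.
have := cantor_derive_inverse i x.
have [_ _ H] := uniform_cantor_lift i; have := H (lift (F i) x).
move: (derive1 (cantor_lift i) _) (derive1 (lift (F i)) x : R) => a b a1 ab.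
have b0 : 0 < b by rewrite -(pmulr_rgt0 _ (_ : 0 < a)) ?ab//; lra.
by rewrite gtr0_norm//; nra.
Qed.

(** The generator inverts a map of slope 3 around x. The radius 1/256 is half of 1/128, so every
    point met has a neighbourhood on which the affine formula holds and can be differentiated. *)
Lemma cantor_contracting : contracting F (1 / 2) (1 / 256).
Proof.
move=> x; have [n [m [n6 Hn]]] := cantor_lift_triples x.
pose i := letter (ltn_trans n6 (isT : (6 < 8)%N)).
have [_ FK FK' Flt _] := Fd i.
have near_x u : x - 1 / 128 <= u <= x + 1 / 128 -> cantor_lift n u = 3 * u + m%:~R / 3.
  by move=> /andP[u1 u2]; apply: Hn; rewrite ler_norml; apply/andP; split; lra.
have Ep : cantor_lift n (x - 1 / 256) = 3 * (x - 1 / 256) + m%:~R / 3.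
  by apply: near_x; apply/andP; split; lra.
have Eq : cantor_lift n (x + 1 / 256) = 3 * (x + 1 / 256) + m%:~R / 3.
  by apply: near_x; apply/andP; split; lra.
have Fp : lift (F i) (cantor_lift n (x - 1 / 256)) = x - 1 / 256 by exact: FK'.
have Fq : lift (F i) (cantor_lift n (x + 1 / 256)) = x + 1 / 256 by exact: FK'.
exists i, (cantor_lift n (x - 1 / 256)), (cantor_lift n (x + 1 / 256)).
rewrite Fp Fq lexx Ep Eq; split=> //; try lra.
move=> u /andP[u1 u2].
have mono a b : a <= b -> lift (F i) a <= lift (F i) b.
  by rewrite le_eqVlt => /orP[/eqP ->//|/Flt/ltW].
have := mono _ _ u1; rewrite -Ep Fp => v1.
have := mono _ _ u2; rewrite -Eq Fq => v2.
have E := cantor_derive_inverse i u.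
have E3 : derive1 (cantor_lift n) (lift (F i) u) = 3.
  suff D : is_derive (lift (F i) u) 1 (cantor_lift n) 3.
    by rewrite derive1E (@derive_val _ _ _ _ _ _ _ D).
  have D0 := affine_derive 3 (m%:~R / 3) (lift (F i) u).
  apply: near_eq_is_derive D0.
  near=> w; rewrite near_x//; apply/andP; split; apply: ltW; near: w;
    [apply: lt_nbhsr|apply: lt_nbhsl]; lra.
move: E; rewrite [derive1 (cantor_lift i) _]E3 => E; lra.
Unshelve. all: by end_near.
Qed.

(* Read backwards, the letters include all the branches of y |-> y / 3 modulo 1/3;
   the two extra letters adjust the residue, using the rotation by 1/3. *)
Lemma cantor_branches n t x (l : int) : 3 ^+ n * t = x + l%:~R / 3 ->
  exists a (m : int), size a = n.+2 /\ wcomp F a x = t + m%:~R.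
Proof.
elim: n t l => [|n IH] t l Et.
  have rot y : lift (F (letter (isT : (6 < 8)%N))) y = y - 1 / 3.
    have [_ _ FK _ _] := Fd (letter (isT : (6 < 8)%N)).
    rewrite -[in LHS](subrK (1 / 3) y) -[X in lift _ (X + _)]mul1r; exact: FK.
  have idl y : lift (F (letter (isT : (7 < 8)%N))) y = y.
    have [_ _ FK _ _] := Fd (letter (isT : (7 < 8)%N)).
    rewrite -[in LHS](addr0 y) -[X in lift _ (X + _)]mul1r; exact: FK.
  have two i j y : wcomp F [:: i; j] y = lift (F j) (lift (F i) y) by [].
  have [j [j3 [q Eq]]] := third_residue l.
  have EqR : l%:~R + j%:R = 3 * q%:~R :> R by rewrite -[j%:R]/(j%:Z%:~R) -intrD Eq intrM.
  move: Et; rewrite expr0 mul1r => Et.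
  (* As l + j = 3 q, rotating x by -1/3 exactly j times gives t - q; the identity letter pads the
     word to length two. *)
  case: j j3 EqR {Eq} => [|[|[|//]]] _ EqR.
  - exists [:: letter (isT : (7 < 8)%N); letter (isT : (7 < 8)%N)], (- q); split=> //.
    by rewrite two !idl mulrNz; lra.
  - exists [:: letter (isT : (7 < 8)%N); letter (isT : (6 < 8)%N)], (- q); split=> //.
    by rewrite two idl rot mulrNz; lra.
  - exists [:: letter (isT : (6 < 8)%N); letter (isT : (6 < 8)%N)], (- q); split=> //.
    by rewrite two !rot mulrNz; lra.
have [i [m [i6 Hi]]] := cantor_lift_triples t.
have Ei : cantor_lift i t = 3 * t + m%:~R / 3 by apply: Hi; rewrite subrr normr0; lra.
have [|a [m' [sa Ea]]] := IH (cantor_lift i t) (l + 3 ^+ n * m).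
  rewrite Ei mulrDr mulrA -exprSr Et intrD intrM rmorphXn /=.
  by rewrite mulrDl addrA -mulrA.
exists (rcons a (letter (ltn_trans i6 (isT : (6 < 8)%N)))), m'; split.
  by rewrite size_rcons sa.
rewrite /wcomp foldl_rcons -/(wcomp _ _ _) Ea.
set j := letter _; have [F1 _ FK _ _] := Fd j.
by rewrite degree_one_int//; congr (_ + _); exact: FK.
Qed.

(** The solutions t of 3^n t = x + l/3 are spaced by 3^-(n+1), so one of them is close to y. The
    exact length matters in [cantor_minimal_uu], where the starting point depends on the length of
    the word. *)
Lemma cantor_exact_spreading n x y : exists2 a, size a = n.+2 &
  circ_dist_le (wcomp F a x) y (3 ^- n).
Proof.
have e0 : 0 < 3 ^+ n :> R by rewrite exprn_gt0.
set e := 3 ^+ n in e0 *.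
have /andP[l1 l2] := floor_itv (3 * (e * y - x)).
set l := Num.floor _ in l1 l2; rewrite intrD in l2.
have Et : e * ((x + l%:~R / 3) / e) = x + l%:~R / 3 by rewrite mulrC mulfVK// gt_eqF.
have [a [m [sa Ea]]] := cantor_branches Et.
exists a => //; exists m; rewrite Ea.
have -> : (x + l%:~R / 3) / e + m%:~R - y - m%:~R = (x + l%:~R / 3 - e * y) / e.
  by field; rewrite gt_eqF.
rewrite normrM [`|e^-1|]gtr0_norm ?invr_gt0// ler_piMl ?invr_ge0 ?(ltW e0)//.
by rewrite ler_norml; apply/andP; split; lra.
Qed.

Let small_power (d : R) : 0 < d -> exists n, 3 ^- n < d.
Proof.
move=> d0.
have : (fun n => (3^-1 : R) ^+ n) @ \oo --> (0 : R).
  by apply: cvg_expr; rewrite gtr0_norm; lra.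
move=> /cvgrPdist_lt/(_ d d0)[n _ Hn].
exists n; have := Hn n (leqnn n); rewrite sub0r normrN exprVn; apply: le_lt_trans.
exact: ler_norm.
Qed.

Lemma cantor_SRT r : reg_ge1 r -> SRT r F.
Proof.
move=> r1; have Fr i : is_circ_diffeo r (F i) by exact: cantor_diffeo.
apply: (@SRT_criterion _ _ F r 27 (1 / 2) 2 (1 / 256)) => //; try lra.
- exact: cantor_lipschitz.
- exact: cantor_contracting.
left; have [n Hn] := @small_power (1 / 256 / 4) ltac:(lra).
exists n.+2 => x y; have [a sa [m Ha]] := cantor_exact_spreading n x y.
by exists a; [rewrite sa|exists m; exact: le_trans Ha (ltW Hn)].
Qed.

Lemma cantor_not_minimal_ss : ~ minimal_ss F.
Proof.
pose i7 := letter (isT : (7 < 8)%N).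
move=> /(_ (fun=> i7, 0)) D.
(* Tripling the arc of radius 1/24 around 1/4 gives (5/8, 7/8), inside the gap (1/2, 1) of K. *)
have e0 : 0 < 1 / 24 :> R by lra.
have [s [[n Es] Ns]] := D (fun=> i7, 1 / 4) 0%N (1 / 24) e0.
have id0 a : wcomp F (mkseq (fun=> i7) a) 0 = 0.
  have [_ _ FK _ _] := Fd i7.
  have Z : lift (F i7) 0 = 0 by have := FK 0; rewrite /= mulr0 addr0.
  elim: a => // a IH; rewrite mkseqS /wcomp foldl_rcons.
  by rewrite -/(wcomp _ _ _) IH.
move: Es Ns; rewrite !iter_Phi /= id0 => -[_ [m]]; rewrite subr0.
set a := mkseq _ _ => Ea [_ [m' /=]].
(* Integers belong to K, and undoing a letter applies a [cantor_lift], which preserves K. *)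
have Ks : Kset s.2.
  have : Kset (wcomp F a s.2).
    rewrite Ea; have := Kset_shift (3 * m) (@Kset0 R).
    by rewrite add0r intrM mulrAC divff ?mul1r.
  elim: a s.2 {Ea} => // i a IH x /IH /(Kset_cantor_lift i).
  by have [_ FK _ _ _] := Fd i; rewrite /= in FK; rewrite /= FK.
have [m2] := Ks 0%N; rewrite expr1 => /andP[k1 k2].
rewrite ltr_norml => /andP[h1 h2].
by apply: (@no_int_between R (m2 - 3 * m') (1 / 8)); rewrite ?intrB ?intrM; lra.
Qed.

(** A leaf leaves free the future of the N-th preimage of p. It is filled with a word [a] steering
    the point close to y, then with the letters of q from -m to m, the first m of which send y to
    [q.2]. Those m letters stretch errors by at most 27^m, whence the precision eps / 27^m. *)
Lemma cantor_minimal_uu : minimal_uu F.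
Proof.
move=> p q m eps eps0.
pose b := mkseq (fun j : nat => q.1 (j%:Z - m%:Z)) m.
have [y Ey] := wcomp_surj Fex b q.2.
have L0 : 0 < 27 ^+ m :> R by rewrite exprn_gt0.
have [n Hn] := small_power (divr_gt0 eps0 L0).
pose N := (n.+2 + m)%N.
pose p' := iter N (Phiinv F) p.
have [a sa [l Ha]] := cantor_exact_spreading n p'.2 y.
pose z : Sigma k * R := (fun i : int =>
  if i < 0 then p'.1 i else nth (q.1 0) (a ++ mkseq (fun j : nat => q.1 (j%:Z - m%:Z)) (m + m.+1)) `|i|%N, p'.2).
have sz : size (a ++ mkseq (fun j : nat => q.1 (j%:Z - m%:Z)) (m + m.+1)) = (n.+2 + (m + m.+1))%N.
  by rewrite size_cat sa size_mkseq.
exists (iter N (Phi F) z); split.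
  exists N, z; split; first by move=> i i0; rewrite /= i0.
  split; first by exists 0; rewrite subrr.
  by split=> //; exists 0; rewrite subrr.
have zab : mkseq (fun j : nat => z.1 j%:Z) N = a ++ b.
  apply: (@eq_from_nth _ (q.1 0)); first by rewrite size_cat !size_mkseq sa.
  move=> j; rewrite size_mkseq => jN; rewrite nth_mkseq//=.
  rewrite !nth_cat sa; case: ltnP => // nj.
  by rewrite !nth_mkseq//; move: jN nj; rewrite /N; lia.
rewrite iter_Phi zab; split => /=.
  move=> i; rewrite ler_norml => /andP[i1 i2].
  have [j Ej] : exists j : nat, i = j%:Z - m%:Z.
    by exists (absz (i + m%:Z)); rewrite gez0_abs ?addrK//; lia.
  have -> : (i + N%:Z < 0) = false by rewrite /N; lia.
  have -> : absz (i + N%:Z) = (n.+2 + j)%N by rewrite /N; lia.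
  by rewrite nth_cat sa ltnNge leq_addr/= addKn nth_mkseq ?Ej//; lia.
rewrite wcomp_cat; exists l; rewrite -Ey.
have := wcomp_lipschitz b (wcomp F a p'.2) (y + l%:~R) (ltW _ : 0 <= 27) cantor_lipschitz.
rewrite wcomp_int// size_mkseq !opprD !addrA => /(_ ltac:(lra)) H.
apply: le_lt_trans H _; rewrite mulrC -ltr_pdivlMr//.
by apply: le_lt_trans Hn.
Qed.

End Family.
End CantorIfs.

Theorem theoremC (R : realType) (k : nat) (r : regularity) :
  (8 <= k)%N -> reg_ge1 r ->
  (exists Phi : 'I_k.+1 -> cmap R,
      SRT r Phi /\ minimal_uu Phi /\ ~ minimal_ss Phi) /\
  (exists Psi : 'I_k -> cmap R,
      SRT r Psi /\ ~ minimal_uu Psi /\ ~ minimal_ss Psi).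
Proof.
move=> k8 r1; have k9 : (8 <= k.+1)%N by exact: leqW.
split.
  exists (@cantor_ifs R k.+1); split; first exact: cantor_SRT.
  by split; [exact: cantor_minimal_uu|exact: cantor_not_minimal_ss].
exists (@fixing_ifs R k); split; first exact: fixing_SRT.
by split; [exact: fixing_not_minimal_uu|exact: fixing_not_minimal_ss].
Qed.
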